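(* Consider the 1D high-order accurate central DG method of degree $K\ge1$ in which the solution polynomials are replaced by their PCP-limited versions at each stage of the third-order SSP Runge–Kutta method, or at each step of the third-order SSP multi-step method. Then: (i) the resulting Runge–Kutta central DG method is physical-constraints-preserving (PCP) under the CFL type condition $$0<\Delta t\le\frac{\hat\omega_1\theta\,\Delta x}{2c},\qquad\theta=\frac{\Delta t}{\tau_{\max}}\in(0,1];$$ (ii) the resulting multi-step central DG method is PCP under the CFL type condition $$0<\Delta t\le\frac{\hat\omega_1\theta\,\Delta x}{2c},\qquad\theta=\frac{\Delta t}{\tau_{\max}}\in\left(0,\tfrac13\right].$$
   Context: **Equations.** Units with speed of light $c=1$; dimension $d=1$. The equation of state is a function $e=e(p,\rho)$ of pressure $p>0$ and rest-mass density $\rho>0$; $h(p,\rho)=1+e(p,\rho)+p/\rho$. To primitive variables $(\rho,v_1,p)$ with $|v_1|<1$, $W=(1-v_1^2)^{-1/2}$, corresponds $\mathbf U=(D,m_1,E)^{\rm T}\in\mathbb R^3$, $D=\rho W$, $m_1=\rho hW^2v_1$, $E=\rho hW^2-p$. The admissible set $\mathcal G$ is the set of $\mathbf U$ whose primitive variables satisfy $\rho>0,p>0,e>0,|v_1|<1$; that is, there is exactly one triple $(\rho,v_1,p)$ with $\rho>0$, $|v_1|<1$, $p>0$ satisfying the three relations, and $e(p,\rho)>0$ for it. For $\mathbf U\in\mathcal G$, $\mathbf F_1(\mathbf U)=(Dv_1,v_1m_1+p,m_1)^{\rm T}$. Put $q(\mathbf U)=E-\sqrt{D^2+m_1^2}$.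 Standing assumptions on the equation of state: $e$ is continuously differentiable on $\mathbb R^+\times\mathbb R^+$; for all $p,\rho>0$, $h\ge\sqrt{1+p^2/\rho^2}+p/\rho$ and $h\big(\frac1\rho-\frac{\partial h}{\partial p}\big)<\frac{\partial h}{\partial\rho}<0$; for every fixed $\rho>0$, $\lim_{p\to0^+}e(p,\rho)=0$, $\lim_{p\to+\infty}e(p,\rho)=+\infty$. **Meshes and spaces.** $I_j=(x_{j-\frac12},x_{j+\frac12})$, $j\in\mathbb Z$, uniform with step $\Delta x$ and centers $x_j$; dual cells $J_{j+\frac12}=(x_j,x_{j+1})$ (boundary effects are disregarded). $x_{j\pm\frac14}=x_j\pm\frac{\Delta x}4$. $\mathbf U_h^I,\mathbf U_h^J$ are piecewise polynomial vector functions of degree at most $K$ on $\{I_j\}$, $\{J_{j+\frac12}\}$. On each half cell $[x_{j\pm\frac14}-\frac{\Delta x}4,x_{j\pm\frac14}+\frac{\Delta x}4]$, let $\{x_{j\pm\frac14}^\alpha\}_{\alpha=1}^Q$ be the Gauss nodes with weights $\omega_\alpha>0$, $\sum\omega_\alpha=1$, $Q\ge K+1$, and $\{\hat x_{j\pm\frac14}^\alpha\}_{\alpha=1}^L$ the Gauss–Lobatto nodes with weights $\hat\omega_\alpha>0$, $\sum\hat\omega_\alpha=1$, $L>(K+3)/2$. **Semi-discrete operator.** With a constant $\tau_{\max}>0$, $\mathscr L(\mathbf U)$ for $\mathbf U=(\mathbf U_h^I,\mathbf U_h^J)$ is the pair $(\mathbf R^I,\mathbf R^J)$ of piecewise polynomials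 of degree at most $K$ on the two meshes such that for every $j$ and every polynomial $w$ of degree at most $K$, $$\int_{I_j}\mathbf R^Iw\,dx=\frac1{\tau_{\max}}\int_{I_j}(\mathbf U_h^J-\mathbf U_h^I)w\,dx+\frac{\Delta x}2\sum_{\alpha=1}^Q\omega_\alpha\Big(\mathbf F_1(\mathbf U_h^J(x_{j-\frac14}^\alpha))w'(x_{j-\frac14}^\alpha)+\mathbf F_1(\mathbf U_h^J(x_{j+\frac14}^\alpha))w'(x_{j+\frac14}^\alpha)\Big)$$ $$\qquad+\mathbf F_1(\mathbf U_h^J(x_{j-\frac12}))w(x_{j-\frac12})-\mathbf F_1(\mathbf U_h^J(x_{j+\frac12}))w(x_{j+\frac12}),$$ and the same identity with $I$ and $J$ exchanged and $j$ replaced by $j+\frac12$ for $\mathbf R^J$ on $J_{j+\frac12}$. **PCP limiter.** Let a cell have solution polynomial $(D(x),m(x),E(x))^{\rm T}$ with average $\overline{\mathbf U}=(\overline D,\overline m,\overline E)^{\rm T}\in\mathcal G$; let $\mathcal S$ be the set of all Gauss and Gauss–Lobatto nodes in the two halves of the cell, and let $\epsilon>0$ be a sufficiently small number such that $\overline D\ge\epsilon$, $q(\overline{\mathbf U})\ge\epsilon$. Step (i): with $D_{\min}=\min_{\mathcal S}D$, put $\hat D=\theta_1(D-\overline D)+\overline D$ with $\theta_1=(\overline D-\epsilon)/(\overline D-D_{\min})$ if $D_{\min}<\epsilon$, $\hat D=D$ otherwise; $\hat{\mathbf U}=(\hat D,m,E)^{\rm T}$. Step (ii): with $q_{\min}=\min_{\mathcal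 S}q(\hat{\mathbf U}(x))$, put $\tilde{\mathbf U}=\theta_2(\hat{\mathbf U}-\overline{\mathbf U})+\overline{\mathbf U}$ with $\theta_2=(q(\overline{\mathbf U})-\epsilon)/(q(\overline{\mathbf U})-q_{\min})$ if $q_{\min}<\epsilon$, $\tilde{\mathbf U}=\hat{\mathbf U}$ otherwise. The limited polynomial is $\tilde{\mathbf U}$. It is applied separately to every cell of both meshes. **Time discretization.** (Runge–Kutta) $$\mathbf U^*=\mathbf U^n+\Delta t\mathscr L(\mathbf U^n),\quad\mathbf U^{**}=\tfrac34\mathbf U^n+\tfrac14(\mathbf U^*+\Delta t\mathscr L(\mathbf U^* )),\quad\mathbf U^{n+1}=\tfrac13\mathbf U^n+\tfrac23(\mathbf U^{**}+\Delta t\mathscr L(\mathbf U^{**})).$$ (Multi-step) $$\mathbf U^{n+1}=\tfrac{16}{27}(\mathbf U^n+3\Delta t\mathscr L(\mathbf U^n))+\tfrac{11}{27}\big(\mathbf U^{n-3}+\tfrac{12}{11}\Delta t\mathscr L(\mathbf U^{n-3})\big).$$ In both, $\mathbf U^n,\mathbf U^*,\mathbf U^{**},\mathbf U^{n-3}$ on the right-hand sides are replaced by their limited versions. **PCP.** A method is PCP if, whenever the cell averages (on both meshes) of the starting data lie in $\mathcal G$ (the data at $t_0$ for the Runge–Kutta method; at the four starting levels $t_0,\dots,t_3$ for the multi-step method), the cell averages of the numerical solution at all later time levels, including intermediate Runge–Kutta stages, lie in $\mathcal G$, and the limited polynomials take values in $\mathcal G$ at all points of $\mathcal S$ in every cell.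 *)

(* Defs.v *)
From HB Require Import structures.
From mathcomp Require Import all_boot all_order all_algebra.
From mathcomp Require Import all_classical all_reals all_analysis.

Set Implicit Arguments.
Unset Strict Implicit.
Unset Printing Implicit Defensive.

Import Order.TTheory GRing.Theory Num.Theory.
Import numFieldNormedType.Exports.

Local Open Scope classical_set_scope.
Local Open Scope ring_scope.

Definition speed_of_light {R : realType} : R := 1.

(** Equation of state: [e p rho] is relevant only for [0 < p] and [0 < rho]. *)

Definition enthalpy (R : realType) (e : R -> R -> R) (p rho : R) : R :=
  1 + e p rho + p / rho.

Definition dpressure (R : realType) (f : R -> R -> R) (p rho : R) : R :=
  derive1 (fun x : R => f x rho) p.

Definition ddensity (R : realType) (f : R -> R -> R) (p rho : R) : R :=
  derive1 (fun y : R => f p y) rho.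

Definition C1_pos (R : realType) (f : R -> R -> R) : Prop :=
  forall p rho : R, 0 < p -> 0 < rho ->
    [/\ derivable (fun x : R => f x rho) p 1,
        derivable (fun y : R => f p y) rho 1,
        {for (p, rho), continuous (fun z : R * R => dpressure f z.1 z.2)}
      & {for (p, rho), continuous (fun z : R * R => ddensity f z.1 z.2)}].

Record eos_assumptions (R : realType) (e : R -> R -> R) : Prop := {
  eos_C1 : C1_pos e;
  eos_enthalpy_lb : forall p rho : R, 0 < p -> 0 < rho ->
    Num.sqrt (1 + p ^+ 2 / rho ^+ 2) + p / rho <= enthalpy e p rho;
  eos_causality : forall p rho : R, 0 < p -> 0 < rho ->
    enthalpy e p rho * (rho^-1 - dpressure (enthalpy e) p rho)
      < ddensity (enthalpy e) p rho < 0;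
  eos_lim_0 : forall rho : R, 0 < rho -> e p rho @[p --> 0^'+] --> 0;
  eos_lim_pinfty : forall rho : R, 0 < rho -> e p rho @[p --> +oo] --> +oo
}.

(** State vectors (D, m_1, E)^T. *)

Definition iD : 'I_3 := @Ordinal 3 0 isT.
Definition im : 'I_3 := @Ordinal 3 1 isT.
Definition iE : 'I_3 := @Ordinal 3 2 isT.

Definition vec3 (R : realType) (a b c : R) : 'cV[R]_3 :=
  \col_i [:: a; b; c]`_i.

Definition conserved (R : realType) (e : R -> R -> R) (rho v p : R) : 'cV[R]_3 :=
  let W := (Num.sqrt (1 - v ^+ 2))^-1 in
  let h := enthalpy e p rho in
  vec3 (rho * W) (rho * h * W ^+ 2 * v) (rho * h * W ^+ 2 - p).

(* Primitive variables are triples w = (rho, v_1, p). *)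
Definition is_primitive (R : realType) (e : R -> R -> R) (U : 'cV[R]_3)
    (w : R * R * R) : Prop :=
  let: (rho, v, p) := w in
  [/\ 0 < rho, `|v| < 1, 0 < p & U = conserved e rho v p].

Definition admissible (R : realType) (e : R -> R -> R) (U : 'cV[R]_3) : Prop :=
  exists2 w : R * R * R, unique (is_primitive e U) w & 0 < e w.2 w.1.1.

Definition primitive (R : realType) (e : R -> R -> R) (U : 'cV[R]_3) :
    R * R * R :=
  xget (0, 0, 0) [set w | is_primitive e U w].

(* Meaningful on admissible states; on states without primitive variables the
   value is arbitrary. *)
Definition flux (R : realType) (e : R -> R -> R) (U : 'cV[R]_3) : 'cV[R]_3 :=
  let: (_, v, p) := primitive e U in
  vec3 (U iD 0 * v) (v * U im 0 + p) (U im 0).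

Definition qfun (R : realType) (U : 'cV[R]_3) : R :=
  U iE 0 - Num.sqrt (U iD 0 ^+ 2 + U im 0 ^+ 2).

(** Quadrature rules on [-1, 1], with nodes and weights numbered from 1 and
    weights normalized to have sum 1. *)

Record quad_rule (R : realType) := QuadRule {
  qsize : nat;
  qnode : nat -> R;
  qweight : nat -> R
}.

Definition quad_sum (R : realType) (q : quad_rule R) (p : {poly R}) : R :=
  \sum_(1 <= a < (qsize q).+1) qweight q a * p.[qnode q a].

Definition polyint (R : realType) (a b : R) (p : {poly R}) : R :=
  \int[lebesgue_measure]_(x in `[a, b]) p.[x].

Record quad_proper (R : realType) (q : quad_rule R) : Prop := {
  quad_increasing : forall a b : nat,
    (1 <= a)%N -> (a < b)%N -> (b <= qsize q)%N -> qnode q a < qnode q b;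
  quad_weight_gt0 : forall a : nat,
    (1 <= a <= qsize q)%N -> 0 < qweight q a;
  quad_weight_sum : \sum_(1 <= a < (qsize q).+1) qweight q a = 1
}.

(* The Q-point Gauss rule: interior nodes, exact in degree <= 2 Q - 1. *)
Definition is_gauss (R : realType) (q : quad_rule R) : Prop :=
  [/\ quad_proper q,
      (forall a : nat, (1 <= a <= qsize q)%N -> -1 < qnode q a < 1)
    & forall p : {poly R}, (size p <= 2 * qsize q)%N ->
        quad_sum q p = polyint (-1) 1 p / 2].

(* The L-point Gauss-Lobatto rule: both endpoints are nodes, exact in degree
   <= 2 L - 3. *)
Definition is_gauss_lobatto (R : realType) (q : quad_rule R) : Prop :=
  [/\ quad_proper q,
      (2 <= qsize q)%N /\ (qnode q 1 = -1 /\ qnode q (qsize q) = 1)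
    & forall p : {poly R}, (size p + 2 <= 2 * qsize q)%N ->
        quad_sum q p = polyint (-1) 1 p / 2].

(** Vector-valued polynomials. *)

Definition vpoly (R : realType) := 'I_3 -> {poly R}.

Definition veval (R : realType) (P : vpoly R) (x : R) : 'cV[R]_3 :=
  \col_i (P i).[x].

Definition vmul (R : realType) (P : vpoly R) (w : {poly R}) : vpoly R :=
  fun i => P i * w.

Definition vint (R : realType) (a b : R) (P : vpoly R) : 'cV[R]_3 :=
  \col_i polyint a b (P i).

Definition average (R : realType) (dx xc : R) (P : vpoly R) : 'cV[R]_3 :=
  dx^-1 *: vint (xc - dx / 2) (xc + dx / 2) P.

(** Meshes. A pair (U^I_h, U^J_h) is stored cellwise: [U.1 j] is the polynomial
    on I_j and [U.2 j] the polynomial on the dual cell J_{j + 1/2}. *)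

Definition dg_pair (R : realType) :=
  ((int -> vpoly R) * (int -> vpoly R))%type.

Definition centerI (R : realType) (x0 dx : R) (j : int) : R := x0 + j%:~R * dx.

Definition centerJ (R : realType) (x0 dx : R) (j : int) : R :=
  centerI x0 dx j + dx / 2.

Definition dg_space (R : realType) (K : nat) (U : dg_pair R) : Prop :=
  forall (j : int) (i : 'I_3),
    (size (U.1 j i) <= K.+1)%N /\ (size (U.2 j i) <= K.+1)%N.

(* The image of reference node y in the half cell with center [hc]
   (and length dx / 2). *)
Definition half_node (R : realType) (dx hc y : R) : R := hc + dx / 4 * y.

(** Semi-discrete operator on one cell with center [xc]. [Uown] is the
    polynomial of this cell; [Uleft] and [Uright] are the polynomials of the two
    cells of the other mesh, which cover its left and right halves and are
    centered at its endpoints. *)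
Definition cell_rhs (R : realType) (e : R -> R -> R) (K : nat) (dx tau_max : R)
    (gq : quad_rule R) (xc : R) (Uown Uleft Uright Rhs : vpoly R) : Prop :=
  let xl := xc - dx / 2 in
  let xr := xc + dx / 2 in
  forall w : {poly R}, (size w <= K.+1)%N ->
    vint xl xr (vmul Rhs w) =
      tau_max^-1 *: (vint xl xc (vmul (Uleft - Uown) w)
                     + vint xc xr (vmul (Uright - Uown) w))
      + (dx / 2) *: (\sum_(1 <= a < (qsize gq).+1)
          let yl := half_node dx (xc - dx / 4) (qnode gq a) in
          let yr := half_node dx (xc + dx / 4) (qnode gq a) in
          qweight gq a *: (w^`().[yl] *: flux e (veval Uleft yl)
                           + w^`().[yr] *: flux e (veval Uright yr)))
      + w.[xl] *: flux e (veval Uleft xl)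
      - w.[xr] *: flux e (veval Uright xr).

Definition is_dg_operator (R : realType) (e : R -> R -> R) (K : nat)
    (x0 dx tau_max : R) (gq : quad_rule R) (U LU : dg_pair R) : Prop :=
  dg_space K LU /\
  forall j : int,
    cell_rhs e K dx tau_max gq (centerI x0 dx j)
      (U.1 j) (U.2 (j - 1)) (U.2 j) (LU.1 j) /\
    cell_rhs e K dx tau_max gq (centerJ x0 dx j)
      (U.2 j) (U.1 j) (U.1 (j + 1)) (LU.2 j).

(** PCP limiter. *)

Definition rule_nodes (R : realType) (dx hc : R) (q : quad_rule R) : seq R :=
  [seq half_node dx hc (qnode q a) | a <- iota 1 (qsize q)].

(* The set S of a cell. *)
Definition limiter_nodes (R : realType) (dx : R) (gq lq : quad_rule R)
    (xc : R) : seq R :=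
  rule_nodes dx (xc - dx / 4) gq ++ rule_nodes dx (xc + dx / 4) gq ++
  rule_nodes dx (xc - dx / 4) lq ++ rule_nodes dx (xc + dx / 4) lq.

(* Minimum of f over a nonempty sequence; the initial value of the iterated
   minimum is the value at the first element. *)
Definition min_on (R : realType) (s : seq R) (f : R -> R) : R :=
  \big[Num.min/f (head 0 s)]_(x <- s) f x.

Definition limit_density (R : realType) (eps : R) (S : seq R) (Ubar : 'cV[R]_3)
    (P : vpoly R) : vpoly R :=
  let Dbar := Ubar iD 0 in
  let Dmin := min_on S (fun x => (P iD).[x]) in
  let theta1 := (Dbar - eps) / (Dbar - Dmin) in
  fun i => if (i == iD) && (Dmin < eps)
           then theta1 *: (P iD - Dbar%:P) + Dbar%:P
           else P i.

Definition limit_q (R : realType) (eps : R) (S : seq R) (Ubar : 'cV[R]_3)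
    (P : vpoly R) : vpoly R :=
  let qmin := min_on S (fun x => qfun (veval P x)) in
  let theta2 := (qfun Ubar - eps) / (qfun Ubar - qmin) in
  fun i => if qmin < eps
           then theta2 *: (P i - (Ubar i 0)%:P) + (Ubar i 0)%:P
           else P i.

Definition pcp_limiter (R : realType) (eps : R) (S : seq R) (Ubar : 'cV[R]_3)
    (P : vpoly R) : vpoly R :=
  limit_q eps S Ubar (limit_density eps S Ubar P).

(* [eps] may depend on the cell and on the application of the limiter. It is
   required to be small exactly when a suitable positive number exists, so that
   a limited version exists for every cell polynomial and assuming one carries
   no information about the cell average. *)
Definition cell_limited (R : realType) (dx : R) (gq lq : quad_rule R) (xc : R)
    (P Pt : vpoly R) : Prop :=
  let Ubar := average dx xc P in
  exists eps : R,
    (0 < Ubar iD 0 -> 0 < qfun Ubar ->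
       [/\ 0 < eps, eps <= Ubar iD 0 & eps <= qfun Ubar]) /\
    Pt = pcp_limiter eps (limiter_nodes dx gq lq xc) Ubar P.

Definition is_limited (R : realType) (x0 dx : R) (gq lq : quad_rule R)
    (U Ut : dg_pair R) : Prop :=
  forall j : int,
    cell_limited dx gq lq (centerI x0 dx j) (U.1 j) (Ut.1 j) /\
    cell_limited dx gq lq (centerJ x0 dx j) (U.2 j) (Ut.2 j).

Definition averages_admissible (R : realType) (e : R -> R -> R) (x0 dx : R)
    (U : dg_pair R) : Prop :=
  forall j : int,
    admissible e (average dx (centerI x0 dx j) (U.1 j)) /\
    admissible e (average dx (centerJ x0 dx j) (U.2 j)).

Definition nodes_admissible (R : realType) (e : R -> R -> R) (x0 dx : R)
    (gq lq : quad_rule R) (U : dg_pair R) : Prop :=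
  forall j : int,
    (forall x : R, x \in limiter_nodes dx gq lq (centerI x0 dx j) ->
       admissible e (veval (U.1 j) x)) /\
    (forall x : R, x \in limiter_nodes dx gq lq (centerJ x0 dx j) ->
       admissible e (veval (U.2 j) x)).

(** Fully discrete methods with limiting. [U n] is the numerical solution at
    t_n before limiting, [Us n] and [Uss n] are the stages U^* and U^** of the
    step from t_n; a trailing [t] denotes the limited version and the [L...] are
    the values of the semi-discrete operator at the limited versions. *)

Record rk_run (R : realType) (e : R -> R -> R) (K : nat) (x0 dx tau_max : R)
    (gq lq : quad_rule R) (dt : R)
    (U Us Uss Ut Ust Usst LU LUs LUss : nat -> dg_pair R) : Prop := {
  rk_initial : dg_space K (U 0%N);
  rk_limited0 : forall n, is_limited x0 dx gq lq (U n) (Ut n);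
  rk_operator0 : forall n, is_dg_operator e K x0 dx tau_max gq (Ut n) (LU n);
  rk_stage1 : forall n, Us n = Ut n + dt *: LU n;
  rk_limited1 : forall n, is_limited x0 dx gq lq (Us n) (Ust n);
  rk_operator1 : forall n, is_dg_operator e K x0 dx tau_max gq (Ust n) (LUs n);
  rk_stage2 : forall n,
    Uss n = (3 / 4 : R) *: Ut n + (1 / 4 : R) *: (Ust n + dt *: LUs n);
  rk_limited2 : forall n, is_limited x0 dx gq lq (Uss n) (Usst n);
  rk_operator2 : forall n, is_dg_operator e K x0 dx tau_max gq (Usst n) (LUss n);
  rk_next : forall n,
    U n.+1 = (1 / 3 : R) *: Ut n + (2 / 3 : R) *: (Usst n + dt *: LUss n)
}.

Definition rk_pcp (R : realType) (e : R -> R -> R) (K : nat) (x0 dx tau_max : R)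
    (gq lq : quad_rule R) (dt : R) : Prop :=
  forall U Us Uss Ut Ust Usst LU LUs LUss : nat -> dg_pair R,
    rk_run e K x0 dx tau_max gq lq dt U Us Uss Ut Ust Usst LU LUs LUss ->
    averages_admissible e x0 dx (U 0%N) ->
    forall n : nat,
      [/\ averages_admissible e x0 dx (U n),
          averages_admissible e x0 dx (Us n)
        & averages_admissible e x0 dx (Uss n)] /\
      [/\ nodes_admissible e x0 dx gq lq (Ut n),
          nodes_admissible e x0 dx gq lq (Ust n)
        & nodes_admissible e x0 dx gq lq (Usst n)].

Record ms_run (R : realType) (e : R -> R -> R) (K : nat) (x0 dx tau_max : R)
    (gq lq : quad_rule R) (dt : R) (U Ut LU : nat -> dg_pair R) : Prop := {
  ms_initial : forall n, (n <= 3)%N -> dg_space K (U n);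
  ms_limited : forall n, is_limited x0 dx gq lq (U n) (Ut n);
  ms_operator : forall n, is_dg_operator e K x0 dx tau_max gq (Ut n) (LU n);
  ms_next : forall n, (3 <= n)%N ->
    U n.+1 = (16 / 27 : R) *: (Ut n + (3 * dt) *: LU n)
           + (11 / 27 : R) *: (Ut (n - 3)%N + (12 / 11 * dt) *: LU (n - 3)%N)
}.

Definition ms_pcp (R : realType) (e : R -> R -> R) (K : nat) (x0 dx tau_max : R)
    (gq lq : quad_rule R) (dt : R) : Prop :=
  forall U Ut LU : nat -> dg_pair R,
    ms_run e K x0 dx tau_max gq lq dt U Ut LU ->
    (forall n, (n <= 3)%N -> averages_admissible e x0 dx (U n)) ->
    forall n : nat,
      averages_admissible e x0 dx (U n) /\
      nodes_admissible e x0 dx gq lq (Ut n).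

(* Main.v *)
Require Import Defs.
From mathcomp Require Import all_boot all_order all_algebra.
From mathcomp Require Import all_classical all_reals all_analysis.
From mathcomp Require Import ring lra zify.
Import Order.TTheory GRing.Theory Num.Theory.
Import numFieldNormedType.Exports.
Local Open Scope ring_scope.

Set Implicit Arguments.
Unset Strict Implicit.
Unset Printing Implicit Defensive.

(** The proof replaces the implicitly defined admissible set by an explicit
    convex cone and shows that one forward Euler step of the scheme writes
    each new cell average as a positive combination of elements of that
    cone.

    The cone. Under the assumptions on the equation of state, a state is
    admissible iff D > 0 and q(U) > 0 ([admissibleP]). Given primitive
    variables, q(U) > 0 follows from h^2 - 2 h p / rho >= 1, a rearrangement
    of the lower bound on h. Conversely, D, m and E being
    given, a pressure p determines the density and the velocity, and p is
    the right pressure iff a scalar residual vanishes at p. The residual is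
    negative near p = 0, where q(U) > 0 enters, and positive for large p,
    because e tends to infinity; and the causality assumption makes its
    derivative positive wherever the residual is nonpositive, so it has
    exactly one zero. As q is concave and positively homogeneous, the states
    with D > 0 and q > 0 form a convex cone.

    The flux. If U is admissible and |t| <= 1 then U + t F(U) lies in the
    closed cone D >= 0, q >= 0 ([physical_add_flux]). The closed cone is
    enough, because adding an element of the closed cone to one of the open
    cone stays in the open cone ([physical_add_weakly]).

    The Euler step. Tested with w = 1 the scheme gives, with th = s /
    tau_max, new average = (1 - th) (old average) + th (average of the other
    mesh's solution over the cell) + (s / dx) (F(left end) - F(right end)).
    Each half of the cell lies in one cell of the other mesh, so the
    Gauss-Lobatto rule computes the second term exactly from point values
    that the limiter has made admissible, and the ends of the cell are among
    the nodes. Merging each flux with the point value at the same place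
    gives terms (th / 2) w (U + t F(U)) with |t| = 2 tau_max / (dx w), where
    w is the weight of the first or of the last node; the CFL condition is
    |t| <= 1. It is formulated with the first weight only, so one has to
    know that the last weight is at least as large
    ([lobatto_first_le_last]).

    The methods. Each stage is a convex combination of Euler steps of length
    at most tau_max applied to limited data. The limiter contracts a cell
    polynomial towards its average, hence keeps the average, and since q is
    concave its contraction factors bring about q >= eps at the nodes
    ([cell_limited_average], [cell_limited_physical]). Induction on
    the time level concludes; in the multi-step method the longer of the two
    Euler steps has length 3 dt, whence the bound th <= 1/3. *)

(** * Integrals of polynomials and the Gauss-Lobatto weights *)

Local Notation horner_opsE :=
  (hornerD, hornerN, hornerZ, hornerC, hornerX, horner_exp, hornerM).

Lemma poly_primitive (R : realType) (p : {poly R}) :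
  exists P : {poly R}, P^`() = p.
Proof.
exists (\poly_(i < (size p).+1) (p`_i.-1 / i%:R)).
apply/polyP => i; rewrite coef_deriv coef_poly ltnS.
case: ltnP => hi /=; last by rewrite mul0rn nth_default.
by rewrite -[LHS]mulr_natr divfK // pnatr_eq0.
Qed.

Lemma polyint_deriv (R : realType) (a b : R) (P : {poly R}) :
  a < b -> polyint a b P^`() = P.[b] - P.[a].
Proof.
move=> ab; rewrite /polyint /Rintegral.
rewrite (@continuous_FTC2 R (fun x => P^`().[x]) (fun x => P.[x])) //.
- exact/continuous_subspaceT/continuous_horner.
- split.
  + by move=> x _; exact: derivable_horner.
  + by apply: cvg_at_right_filter; exact: continuous_horner.
  + by apply: cvg_at_left_filter; exact: continuous_horner.
- by move=> x _; rewrite derivE.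
Qed.

Lemma polyintD (R : realType) (a b : R) (p q : {poly R}) : a < b ->
  polyint a b (p + q) = polyint a b p + polyint a b q.
Proof.
move=> ab; have [P <-] := poly_primitive p; have [Q <-] := poly_primitive q.
by rewrite -derivD !polyint_deriv // !hornerD; ring.
Qed.

Lemma polyintZ (R : realType) (a b c : R) (p : {poly R}) : a < b ->
  polyint a b (c *: p) = c * polyint a b p.
Proof.
move=> ab; have [P <-] := poly_primitive p.
by rewrite -derivZ !polyint_deriv // !horner_opsE; ring.
Qed.

Lemma polyintC (R : realType) (a b c : R) : a < b ->
  polyint a b c%:P = c * (b - a).
Proof.
move=> ab.
have -> : c%:P = (c *: 'X)^`() :> {poly R} by rewrite derivZ derivX alg_polyC.
by rewrite polyint_deriv // !horner_opsE; ring.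
Qed.

Lemma polyint_chasles (R : realType) (a b c : R) (p : {poly R}) :
  a < b -> b < c -> polyint a c p = polyint a b p + polyint b c p.
Proof.
move=> ab bc; have [P <-] := poly_primitive p.
by rewrite !polyint_deriv ?(lt_trans ab bc) //; ring.
Qed.

Lemma polyint_affine (R : realType) (hc k : R) (p : {poly R}) : 0 < k ->
  polyint (-1) 1 (p \Po (hc%:P + k *: 'X)) = k^-1 * polyint (hc - k) (hc + k) p.
Proof.
move=> k0; have [P <-] := poly_primitive p.
have -> : P^`() \Po (hc%:P + k *: 'X) = (k^-1 *: (P \Po (hc%:P + k *: 'X)))^`().
  rewrite derivZ deriv_comp derivD derivC derivZ derivX add0r alg_polyC.
  by rewrite mulrC mul_polyC scalerA mulVf ?scale1r ?gt_eqF.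
have h1 : (-1 : R) < 1 by lra.
have h2 : hc - k < hc + k by lra.
rewrite !polyint_deriv // !horner_opsE !horner_comp !horner_opsE.
by rewrite mulrN1 mulr1 mulrBr.
Qed.

Lemma polyint_reflect (R : realType) (p : {poly R}) :
  polyint (-1) 1 (p \Po - 'X) = polyint (-1) 1 p.
Proof.
have [P <-] := poly_primitive p.
have -> : P^`() \Po - 'X = (- (P \Po - 'X))^`().
  by rewrite derivN deriv_comp derivN derivX mulrN1 opprK.
have h1 : (-1 : R) < 1 by lra.
rewrite !polyint_deriv // !horner_opsE !horner_comp !horner_opsE.
by rewrite !opprK addrC.
Qed.

(** Let w vanish at the interior nodes. The rule is exact for (1 + X) w^2 and
    for (1 - X) w(-X)^2, which have degree 2 L - 3 and are mirror images of
    each other, hence have the same integral. In the first sum only the last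
    node contributes, in the second one the first node contributes the same
    factor and the other terms are nonnegative. *)
Lemma lobatto_first_le_last (R : realType) (q : quad_rule R) :
  is_gauss_lobatto q -> qweight q 1 <= qweight q (qsize q).
Proof.
case=> -[qinc qpos _] [L2 [nodeN1 node1]] exact_.
set L := qsize q in qinc qpos L2 node1 exact_ *.
pose w := \prod_(2 <= a < L) ('X - (qnode q a)%:P) : {poly R}.
have sw : (size w <= L - 1)%N.
  by rewrite /w size_prod_XsubC size_iota; lia.
have w1 : 0 < w.[1].
  rewrite /w horner_prod big_nat_cond.
  apply: prodr_gt0 => a /andP[/andP[a2 aL] _].
  by rewrite !horner_opsE subr_gt0 -node1; apply: qinc; lia.
have w_node a : (2 <= a < L)%N -> w.[qnode q a] = 0.
  move=> ha; rewrite /w horner_prod (bigD1_seq a) ?iota_uniq //=; last first.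
    by rewrite mem_index_iota.
  by rewrite !horner_opsE subrr mul0r.
have node_le1 a : (1 <= a <= L)%N -> qnode q a <= 1.
  move=> /andP[a1]; rewrite leq_eqVlt => /orP[/eqP->|aL].
    by rewrite node1.
  by rewrite -node1 ltW // qinc.
have size2 (l r : {poly R}) : (size l <= 2)%N -> (size r <= L - 1)%N ->
    (size (l * r ^+ 2)%R + 2 <= 2 * L)%N.
  move=> sl sr; have := size_polyMleq l (r * r).
  by rewrite expr2; have := size_polyMleq r r; lia.
have E1 := exact_ ((1 + 'X) * w ^+ 2).
have E2 := exact_ ((1 - 'X) * (w \Po - 'X) ^+ 2).
have sX : (size (1 + 'X : {poly R})%R <= 2)%N.
  by apply: (leq_trans (size_polyD _ _)); rewrite size_poly1 size_polyX.
have sX' : (size (1 - 'X : {poly R})%R <= 2)%N.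
  apply: (leq_trans (size_polyD _ _)).
  by rewrite size_poly1 size_polyN size_polyX.
have {}E1 := E1 (size2 _ _ sX sw).
have {}E2 : quad_sum q ((1 - 'X) * (w \Po - 'X) ^+ 2) =
    polyint (-1) 1 ((1 - 'X) * (w \Po - 'X) ^+ 2) / 2.
  apply: E2; apply: size2 => //.
  apply: (leq_trans (size_comp_poly_leq _ _)).
  by rewrite size_polyN size_polyX; lia.
have EE : quad_sum q ((1 - 'X) * (w \Po - 'X) ^+ 2) =
    quad_sum q ((1 + 'X) * w ^+ 2).
  rewrite E1 E2 -polyint_reflect; congr (polyint _ _ _ / _).
  rewrite comp_polyM comp_polyB comp_polyX opprK comp_polyC; congr (_ * _).
  rewrite !expr2 comp_polyM -comp_polyA.
  have -> : (- 'X : {poly R}) \Po - 'X = 'X.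
    by rewrite -[X in X \Po _]mulN1r -polyCN comp_polyM comp_polyC comp_polyX
               polyCN mulN1r opprK.
  by rewrite comp_polyXr.
have Q1 : quad_sum q ((1 + 'X) * w ^+ 2) = qweight q L * (2 * w.[1] ^+ 2).
  rewrite /quad_sum big_nat_recr //=; last lia.
  rewrite big1_seq ?add0r -/L ?node1 ?horner_opsE //; last first.
    move=> a; rewrite mem_index_iota => /andP[_ /andP[a1 aL]].
    case: (ltnP 1 a) => ha.
      by rewrite !horner_opsE w_node ?ha // expr0n /= !mulr0.
    (* the first node is a zero of 1 + X *)
    have -> : a = 1%N by lia.
    by rewrite nodeN1 !horner_opsE subrr !mul0r mulr0.
have Q2 : qweight q 1 * (2 * w.[1] ^+ 2) <=
    quad_sum q ((1 - 'X) * (w \Po - 'X) ^+ 2).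
  rewrite /quad_sum big_ltn; last by rewrite ltnS; lia.
  rewrite nodeN1 !horner_opsE horner_comp !horner_opsE opprK.
  rewrite -[X in X <= _]addr0; apply: lerD; first by lra.
  rewrite big_nat_cond; apply: sumr_ge0 => a; rewrite andbT => ha.
  apply: mulr_ge0; first by apply/ltW/qpos; lia.
  rewrite !horner_opsE; apply: mulr_ge0; last by rewrite exprn_even_ge0.
  by rewrite subr_ge0 node_le1 //; lia.
have w2 : 0 < 2 * w.[1] ^+ 2 by rewrite mulr_gt0 // exprn_gt0.
by rewrite -(ler_pM2r w2) -Q1 -EE.
Qed.

(** * The convex cone of states with D > 0 and q > 0 *)

Lemma vec3E (R : realType) (a b c : R) :
  (vec3 a b c iD 0 = a) * (vec3 a b c im 0 = b) * (vec3 a b c iE 0 = c).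
Proof. by rewrite !mxE. Qed.

Lemma state_eq (R : realType) (U V : 'cV[R]_3) :
  U iD 0 = V iD 0 -> U im 0 = V im 0 -> U iE 0 = V iE 0 -> U = V.
Proof.
move=> hD hm hE; apply/colP => -[[|[|[|//]]] hi].
- by rewrite (_ : Ordinal hi = iD) //; exact: val_inj.
- by rewrite (_ : Ordinal hi = im) //; exact: val_inj.
- by rewrite (_ : Ordinal hi = iE) //; exact: val_inj.
Qed.

Lemma sqrt_sum_sq_triangle (R : realType) (a b c d : R) :
  Num.sqrt ((a + c) ^+ 2 + (b + d) ^+ 2) <=
  Num.sqrt (a ^+ 2 + b ^+ 2) + Num.sqrt (c ^+ 2 + d ^+ 2).
Proof.
have ss (x y : R) : 0 <= x ^+ 2 + y ^+ 2 by rewrite addr_ge0 ?sqr_ge0.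
have s0 := sqrtr_ge0 (a ^+ 2 + b ^+ 2); have t0 := sqrtr_ge0 (c ^+ 2 + d ^+ 2).
have s2 := sqr_sqrtr (ss a b); have t2 := sqr_sqrtr (ss c d).
set s := Num.sqrt (a ^+ 2 + b ^+ 2) in s0 s2 *.
set t := Num.sqrt (c ^+ 2 + d ^+ 2) in t0 t2 *.
rewrite -(ler_pXn2r (n := 2)) ?nnegrE ?sqrtr_ge0 ?addr_ge0 // sqr_sqrtr //.
have st0 : 0 <= s * t by exact: mulr_ge0.
have : a * c + b * d <= s * t.
  apply: (le_trans (ler_norm _)).
  rewrite -(ler_pXn2r (n := 2)) ?nnegrE // real_normK ?num_real // exprMn s2 t2.
  have -> : (a ^+ 2 + b ^+ 2) * (c ^+ 2 + d ^+ 2) =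
    (a * c + b * d) ^+ 2 + (a * d - b * c) ^+ 2 by ring.
  by rewrite lerDl sqr_ge0.
have -> : (s + t) ^+ 2 = s ^+ 2 + t ^+ 2 + 2 * (s * t) by ring.
rewrite s2 t2; lra.
Qed.

(** Concavity of q in the form used throughout: with [qfunZ] it makes the
    states with q > 0 a convex cone. *)
Lemma qfunD (R : realType) (U V : 'cV[R]_3) : qfun U + qfun V <= qfun (U + V).
Proof.
rewrite /qfun !mxE.
have := sqrt_sum_sq_triangle (U iD 0) (U im 0) (V iD 0) (V im 0); lra.
Qed.

Lemma qfunZ (R : realType) (a : R) (U : 'cV[R]_3) :
  0 <= a -> qfun (a *: U) = a * qfun U.
Proof.
move=> a0; rewrite /qfun !mxE !exprMn -mulrDr sqrtrM ?sqr_ge0 //.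
by rewrite sqrtr_sqr ger0_norm // mulrBr.
Qed.

(** Eliminates the square root, so that q > 0 becomes polynomial. *)
Lemma qfun_gt0E (R : realType) (U : 'cV[R]_3) :
  (0 < qfun U) = (0 < U iE 0) && (U iD 0 ^+ 2 + U im 0 ^+ 2 < U iE 0 ^+ 2).
Proof.
have ss : 0 <= U iD 0 ^+ 2 + U im 0 ^+ 2 by rewrite addr_ge0 ?sqr_ge0.
rewrite /qfun subr_gt0; case: (ltP 0 (U iE 0)) => hE /=; last first.
  by apply/negbTE; rewrite -leNgt (le_trans hE) ?sqrtr_ge0.
rewrite -(ltr_pXn2r (n := 2)) ?nnegrE ?sqrtr_ge0 ?(ltW hE) //.
by rewrite sqr_sqrtr.
Qed.

Lemma qfun_ge0 (R : realType) (U : 'cV[R]_3) :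
  0 <= U iE 0 -> U iD 0 ^+ 2 + U im 0 ^+ 2 <= U iE 0 ^+ 2 -> 0 <= qfun U.
Proof.
move=> hE h; rewrite /qfun subr_ge0.
rewrite -(ler_pXn2r (n := 2)) ?nnegrE ?sqrtr_ge0 //.
by rewrite sqr_sqrtr // addr_ge0 ?sqr_ge0.
Qed.

(** By [admissibleP] these are the admissible states, for every equation of
    state that satisfies the assumptions. *)
Definition physical (R : realType) (U : 'cV[R]_3) : Prop :=
  0 < U iD 0 /\ 0 < qfun U.

Lemma physicalZ (R : realType) (a : R) (U : 'cV[R]_3) :
  0 < a -> physical U -> physical (a *: U).
Proof.
by move=> a0 [hD hq]; split; rewrite ?qfunZ ?mxE ?mulr_gt0 // ltW.
Qed.

(** The closure of the cone; it contains the zero state. *)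
Definition weakly_physical (R : realType) (U : 'cV[R]_3) : Prop :=
  0 <= U iD 0 /\ 0 <= qfun U.

Lemma physicalW (R : realType) (U : 'cV[R]_3) : physical U -> weakly_physical U.
Proof. by case=> /ltW ? /ltW. Qed.

Lemma physical_add_weakly (R : realType) (U V : 'cV[R]_3) :
  physical U -> weakly_physical V -> physical (U + V).
Proof.
move=> [UD Uq] [VD Vq]; split; first by rewrite mxE ltr_wpDr.
by apply: lt_le_trans (qfunD U V); rewrite ltr_wpDr.
Qed.

Lemma physicalD (R : realType) (U V : 'cV[R]_3) :
  physical U -> physical V -> physical (U + V).
Proof. by move=> hU /physicalW; exact: physical_add_weakly. Qed.

Lemma weakly_physical0 (R : realType) : weakly_physical (0 : 'cV[R]_3).
Proof. by split; rewrite ?qfun_ge0 ?mxE // expr0n addr0. Qed.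

Lemma weakly_physicalD (R : realType) (U V : 'cV[R]_3) :
  weakly_physical U -> weakly_physical V -> weakly_physical (U + V).
Proof.
move=> [UD Uq] [VD Vq]; split; first by rewrite mxE addr_ge0.
by apply: le_trans (qfunD U V); rewrite addr_ge0.
Qed.

Lemma weakly_physicalZ (R : realType) (a : R) (U : 'cV[R]_3) :
  0 <= a -> weakly_physical U -> weakly_physical (a *: U).
Proof.
by move=> a0 [hD hq]; split; rewrite ?qfunZ ?mxE ?mulr_ge0.
Qed.

(** * Inequalities satisfied by primitive variables *)

(** The number k is the reciprocal 1 / W of the Lorentz factor. *)
Lemma lorentz_inv (R : realType) (v : R) : `|v| < 1 ->
  exists2 k : R, 0 < k & Num.sqrt (1 - v ^+ 2) = k /\ k ^+ 2 = 1 - v ^+ 2.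
Proof.
move=> hv; have h : 0 < 1 - v ^+ 2.
  by rewrite subr_gt0 -real_normK ?num_real // exprn_ilt1.
by exists (Num.sqrt (1 - v ^+ 2)); rewrite ?sqrtr_gt0 // sqr_sqrtr // ltW.
Qed.

(** The lower bound on h, squared: with sigma = p / rho it says that
    (h - sigma)^2 >= 1 + sigma^2. The second inequality is the form in which it
    governs the sign of q. *)
Lemma enthalpy_sqr_ge (R : realType) (e : R -> R -> R) (p rho : R) :
  eos_assumptions e -> 0 < p -> 0 < rho ->
  1 < enthalpy e p rho /\
  1 + 2 * enthalpy e p rho * (p / rho) <= enthalpy e p rho ^+ 2.
Proof.
move=> he p0 r0; have := eos_enthalpy_lb he p0 r0.
set h := enthalpy e p rho; rewrite -expr_div_n; set s := p / rho.
have s0 : 0 < s by exact: divr_gt0.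
have hs : 1 <= Num.sqrt (1 + s ^+ 2).
  by rewrite -[leLHS]sqrtr1 ler_wsqrtr // lerDl sqr_ge0.
have hs2 : Num.sqrt (1 + s ^+ 2) ^+ 2 = 1 + s ^+ 2.
  by rewrite sqr_sqrtr // addr_ge0 // sqr_ge0.
move=> lb; split; first lra.
have : Num.sqrt (1 + s ^+ 2) ^+ 2 <= (h - s) ^+ 2.
  by rewrite ler_pXn2r ?nnegrE ?sqrtr_ge0 //; lra.
rewrite hs2; have -> : (h - s) ^+ 2 = h ^+ 2 - 2 * h * s + s ^+ 2 by ring.
lra.
Qed.

Lemma eos_gt0 (R : realType) (e : R -> R -> R) (p rho : R) :
  eos_assumptions e -> 0 < p -> 0 < rho -> 0 < e p rho.
Proof.
move=> he p0 r0; have := eos_enthalpy_lb he p0 r0; rewrite /enthalpy.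
have : 1 < Num.sqrt (1 + p ^+ 2 / rho ^+ 2).
  by rewrite -[ltLHS]sqrtr1 ltr_sqrt ?ltrDl ?divr_gt0 ?exprn_gt0 // addr_gt0 //
    divr_gt0 ?exprn_gt0.
lra.
Qed.

(** With W the Lorentz factor, E^2 - D^2 - m^2 equals
    rho^2 W^2 (h^2 - 2 h p / rho - 1) + p^2, and p^2 makes it positive. *)
Lemma primitive_physical (R : realType) (e : R -> R -> R) (U : 'cV[R]_3) w :
  eos_assumptions e -> is_primitive e U w -> physical U.
Proof.
case: w => [[rho v] p] he [r0 hv p0 ->].
have [k k0 [kE k2]] := lorentz_inv hv.
have [h1 h2] := enthalpy_sqr_ge he p0 r0.
rewrite /physical qfun_gt0E /conserved kE !vec3E.
set h := enthalpy e p rho in h1 h2 *.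
have rk0 : 0 < rho / k by exact: divr_gt0.
split => //.
have hp : rho + 2 * h * p <= h ^+ 2 * rho.
  have -> : rho + 2 * h * p = (1 + 2 * h * (p / rho)) * rho.
    by field; rewrite gt_eqF.
  by rewrite ler_pM2r.
have k1 : k ^+ 2 <= 1 by rewrite k2 gerDl oppr_le0 sqr_ge0.
have ki : 1 <= k^-1 ^+ 2 by rewrite exprVn invf_ge1 // exprn_gt0.
have hr0 : 0 < rho * h by rewrite mulr_gt0 //; lra.
have E0 : 0 < rho * h * k^-1 ^+ 2 - p.
  have : rho * h <= rho * h * k^-1 ^+ 2 by rewrite ler_pMr.
  have : p < rho * h.
    have : (2 * p) * h < (h * rho) * h by move: hp; rewrite expr2; lra.
    by rewrite ltr_pM2r; lra.
  lra.
rewrite E0 /= -subr_gt0.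
have -> : (rho * h * k^-1 ^+ 2 - p) ^+ 2 -
    ((rho * k^-1) ^+ 2 + (rho * h * k^-1 ^+ 2 * v) ^+ 2) =
   rho * k^-1 ^+ 2 * (h ^+ 2 * rho - (rho + 2 * h * p)) + p ^+ 2.
  have -> : (rho * h * k^-1 ^+ 2 * v) ^+ 2 =
     (rho * h * k^-1 ^+ 2) ^+ 2 - (rho * h * k^-1 ^+ 2) ^+ 2 * k ^+ 2.
    by rewrite k2; ring.
  by field; rewrite gt_eqF.
rewrite ltr_wpDl ?exprn_gt0 // mulr_ge0 ?subr_ge0 //.
by rewrite mulr_ge0 ?sqr_ge0 // ltW.
Qed.

(** Since U + t F is a convex combination of U + F and U - F, it suffices to
    treat t = 1 and t = -1. There the difference E^2 - D^2 - m^2, taken for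
    the state U + t F, factors as (1 + t v)^2 W^2 rho^2
    (h^2 - 2 h p / rho - 1), where rho, v, p, h and W belong to U. *)
Lemma physical_add_flux (R : realType) (e : R -> R -> R) (U : 'cV[R]_3)
    (rho v p t : R) :
  eos_assumptions e -> is_primitive e U (rho, v, p) -> `|t| <= 1 ->
  weakly_physical
    (U + t *: vec3 (U iD 0 * v) (v * U im 0 + p) (U im 0)).
Proof.
move=> he hU ht; set F := vec3 _ _ _.
have wp (s : R) : s ^+ 2 = 1 -> weakly_physical (U + s *: F).
  move=> s2.
  have hs : `|s| = 1.
    by apply/eqP; rewrite -sqrp_eq1 // real_normK ?num_real // s2.
  have [hD _] := primitive_physical he hU.
  case: hU => r0 hv p0 UE.
  have [k k0 [kE k2]] := lorentz_inv hv.
  have [h1 h2] := enthalpy_sqr_ge he p0 r0.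
  have sv : `|s * v| < 1 by rewrite normrM hs mul1r.
  have [a0 b0] : 0 < 1 + s * v /\ 0 < 1 - s * v.
    by move: sv; rewrite ltr_norml; lra.
  have b2 : 1 - s * v <= 2 by lra.
  have k2' : k ^+ 2 = (1 - s * v) * (1 + s * v).
    have -> : (1 - s * v) * (1 + s * v) = 1 - s ^+ 2 * v ^+ 2 by ring.
    by rewrite s2 mul1r.
  have U0 : U iD 0 = rho / k by rewrite UE /conserved kE vec3E.
  have [U1 U2] : U im 0 = rho * enthalpy e p rho * k^-1 ^+ 2 * v /\
      U iE 0 = rho * enthalpy e p rho * k^-1 ^+ 2 - p.
    by rewrite UE /conserved kE !vec3E.
  set h := enthalpy e p rho in h1 h2 U1 U2.
  have hp : rho + 2 * h * p <= h ^+ 2 * rho.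
    have -> : rho + 2 * h * p = (1 + 2 * h * (p / rho)) * rho.
      by field; rewrite gt_eqF.
    by rewrite ler_pM2r.
  have hr2 : 2 * p <= rho * h.
    have : (2 * p) * h <= (h * rho) * h by move: hp; rewrite expr2; lra.
    by rewrite ler_pM2r; lra.
  set X := rho * h * k^-1 ^+ 2 in U1 U2.
  have XE : X * (1 + s * v) = rho * h / (1 - s * v).
    by rewrite /X exprVn k2'; field; rewrite !gt_eqF.
  split; rewrite ?mxE ?vec3E.
    have -> : U iD 0 + s * (U iD 0 * v) = U iD 0 * (1 + s * v) by ring.
    by rewrite mulr_ge0 // ltW.
  apply: qfun_ge0; rewrite !mxE /= ?U0 U1 U2.
    have -> : X - p + s * (X * v) = X * (1 + s * v) - p by ring.
    rewrite XE subr_ge0 ler_pdivlMr // (le_trans _ hr2) //.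
    by rewrite mulrC ler_pM2r.
  rewrite -subr_ge0.
  have -> : (X - p + s * (X * v)) ^+ 2 -
     ((rho / k + s * (rho / k * v)) ^+ 2
      + (X * v + s * (v * (X * v) + p)) ^+ 2) =
     (1 + s * v) ^+ 2 * (X ^+ 2 * (1 - v ^+ 2) - 2 * X * p - (rho / k) ^+ 2).
    by move/eqP: s2; rewrite sqrf_eq1 => /orP[] /eqP ->; ring.
  rewrite -k2; apply: mulr_ge0; first exact: sqr_ge0.
  have -> : X ^+ 2 * k ^+ 2 - 2 * X * p - (rho / k) ^+ 2 =
      rho * k^-1 ^+ 2 * (h ^+ 2 * rho - (rho + 2 * h * p)).
    by rewrite /X; field; rewrite gt_eqF.
  rewrite mulr_ge0 ?subr_ge0 // mulr_ge0 ?sqr_ge0 //.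
  exact: ltW.
have -> : U + t *: F =
    ((1 + t) / 2) *: (U + 1 *: F) + ((1 - t) / 2) *: (U + (-1) *: F).
  by apply/matrixP => i j; rewrite !mxE; field.
move: ht; rewrite ler_norml => ht.
apply: weakly_physicalD; apply: weakly_physicalZ;
  [lra | apply: wp; ring | lra | apply: wp; ring].
Qed.

(** * The chain rule along a curve *)

Local Open Scope classical_set_scope.

(** The mean value theorem with the points in either order and an approximate
    value of the derivative. *)
Lemma mean_value_approx (R : realType) (phi : R -> R) (a b l eps : R) :
  (forall x, Num.min a b <= x <= Num.max a b ->
     derivable phi x 1 /\ `|l - derive1 phi x| <= eps) ->
  `|l * (b - a) - (phi b - phi a)| <= eps * `|b - a|.
Proof.
wlog ab : a b / a <= b => [wlg|hphi].
  case/orP: (le_total a b) => [ab|ba]; first exact: wlg.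
  move=> hphi; rewrite [in leRHS]distrC -[leLHS]normrN.
  have -> : - (l * (b - a) - (phi b - phi a)) =
      l * (a - b) - (phi a - phi b) by ring.
  by apply: wlg => // x hx; apply: hphi; rewrite minC maxC.
rewrite min_l // max_r // in hphi.
have der x : x \in `]a, b[%R -> is_derive x 1 phi (derive1 phi x).
  rewrite in_itv /= => /andP[ax xb].
  have [dx _] := hphi x (introT andP (conj (ltW ax) (ltW xb))).
  by rewrite derive1E; exact: derivableP.
have cont : {within `[a, b], continuous phi}.
  by apply: derivable_within_continuous => x; rewrite in_itv /= => /hphi[].
have [c] := MVT_segment ab der cont.
rewrite in_itv /= => /hphi[_ hc] ->.
by rewrite -mulrBl normrM ler_wpM2r.
Qed.

(** Split f(x, r(x)) as f(p, r(x)), to which the one-variable chain rule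
    applies, plus f(x, r(x)) - f(p, r(x)). The difference quotient of the
    latter is close to the partial derivative at (p, r(p)) by the mean value
    theorem and continuity of that partial derivative. *)
Lemma C1_pos_chain (R : realType) (f : R -> R -> R) (r : R -> R) (p d : R) :
  C1_pos f -> 0 < p -> 0 < r p -> is_derive p 1 r d ->
  is_derive p 1 (fun x => f x (r x))
    (dpressure f p (r p) + ddensity f p (r p) * d).
Proof.
move=> hf p0 rp0 dr.
have [_ drho cont _] := hf p (r p) p0 rp0.
have d2 : is_derive p 1 (f p \o r) (ddensity f p (r p) * d).
  rewrite /ddensity derive1E.
  exact: (is_derive1_comp (g := r) (derivableP drho) dr).
pose g x := f x (r x) - f p (r x).
have dg : is_derive p 1 g (dpressure f p (r p)).
  suff cv : h^-1 *: (g (h *: 1 + p) - g p) @[h --> 0^'] --> dpressure f p (r p).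
    apply: DeriveDef; first by apply/cvg_ex; exists (dpressure f p (r p)).
    exact: cvg_lim cv.
  apply/cvgrPdist_le => eps eps0.
  have /cvgrPdist_le/(_ _ eps0)/nbhs_ballP[del /= del0 hdel] := cont.
  have cr : {for p, continuous r}.
    by apply: differentiable_continuous; apply/derivable1_diffP; case: dr.
  have m0 : 0 < Num.min del (r p) by rewrite lt_min del0.
  have /cvgrPdist_lt/(_ _ m0)/nbhs_ballP[del2 /= del20 hdel2] := cr.
  near=> h.
  have h0 : h != 0 by near: h; exact: nbhs_dnbhs_neq.
  have hm : `|h| < Num.min (Num.min del p) del2.
    near: h; apply: dnbhs0_lt.
    by rewrite !lt_min del0 p0.
  move: hm; rewrite !lt_min => /andP[/andP[hdel1 hp] hd2].
  have := hdel2 (p + h).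
  rewrite /ball /= opprD addNKr normrN => /(_ hd2).
  rewrite lt_min => /andP[hr1 hr2].
  have ry0 : 0 < r (p + h) by move: hr2; rewrite ltr_norml; lra.
  have := @mean_value_approx R (fun x => f x (r (p + h))) p (p + h)
    (dpressure f p (r p)) eps.
  rewrite addrAC subrr add0r => mv.
  rewrite /g subrr subr0 scaler1 [h + p]addrC.
  have -> : dpressure f p (r p)
      - h^-1 *: (f (p + h) (r (p + h)) - f p (r (p + h))) =
    h^-1 * (dpressure f p (r p) * h
            - (f (p + h) (r (p + h)) - f p (r (p + h)))).
    by rewrite /GRing.scale /=; field.
  rewrite normrM normfV ler_pdivrMl ?normr_gt0 // [leRHS]mulrC; apply: mv => x.
  move: hp hdel1; rewrite !ltr_norml => hp hdel1.
  rewrite /Num.min /Num.max /Order.min /Order.max => hx.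
  have x0 : 0 < x by move: hx; case: ifP => _ /andP[]; lra.
  have xd : `|p - x| < del.
    by rewrite ltr_norml; move: hx; case: ifP => _ /andP[]; lra.
  have [? _ _ _] := hf x (r (p + h)) x0 ry0; split => //.
  by apply: (hdel (x, r (p + h))); split.
have -> : (fun x => f x (r x)) = g \+ (f p \o r).
  by apply/funext => x; rewrite /g /= subrK.
exact: is_deriveD.
Unshelve. all: by end_near.
Qed.

(** * The pressure equation *)

(** This rule and the next two have functions written pointwise, the form in
    which the composite functions below occur. *)
Lemma is_derive_mul (R : realType) (f g : R -> R) (x df dg : R) :
  is_derive x 1 f df -> is_derive x 1 g dg ->
  is_derive x 1 (fun y => f y * g y) (df * g x + f x * dg).
Proof.
move=> hf hg; rewrite addrC [df * _]mulrC; exact: (@is_deriveM _ _ f g).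
Qed.
Lemma is_derive_inv (R : realType) (f : R -> R) (x df : R) :
  f x != 0 -> is_derive x 1 f df ->
  is_derive x 1 (fun y => (f y)^-1) (- (df / f x ^+ 2)).
Proof.
move=> f0 hf. apply: (is_derive_eq (is_deriveV f0 hf)).
by rewrite /GRing.scale /= mulNr mulrC.
Qed.
Lemma is_derive_add (R : realType) (f g : R -> R) (x df dg : R) :
  is_derive x 1 f df -> is_derive x 1 g dg ->
  is_derive x 1 (fun y => f y + g y) (df + dg).
Proof. exact: is_deriveD. Qed.

Lemma eos_dpressure (R : realType) (e : R -> R -> R) (p rho : R) :
  C1_pos e -> 0 < p -> 0 < rho ->
  dpressure (enthalpy e) p rho = dpressure e p rho + rho^-1.
Proof.
move=> he p0 r0; have [dp _ _ _] := he p rho p0 r0.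
rewrite /dpressure !derive1E; apply: derive_val.
have d := is_derive_add
  (is_derive_add (is_derive_cst (1 : R) p 1) (derivableP dp))
  (is_derive_mul (is_derive_id p 1) (is_derive_cst rho^-1 p 1)).
apply: (is_derive_eq d).
by rewrite add0r mul1r mulr0 addr0.
Qed.

Lemma eos_ddensity (R : realType) (e : R -> R -> R) (p rho : R) :
  C1_pos e -> 0 < p -> 0 < rho ->
  derivable (enthalpy e p) rho 1 /\
  ddensity (enthalpy e) p rho = ddensity e p rho - p / rho ^+ 2.
Proof.
move=> he p0 r0; have [_ dr _ _] := he p rho p0 r0.
have d := is_derive_add
  (is_derive_add (is_derive_cst (1 : R) rho 1) (derivableP dr))
  (is_derive_mul (is_derive_cst p rho 1)
     (is_derive_inv (lt0r_neq0 r0) (is_derive_id rho 1))).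
split; first by case: d.
rewrite /ddensity !derive1E; apply: derive_val; apply: (is_derive_eq d).
by rewrite add0r mul0r add0r mulrN mul1r.
Qed.

Lemma enthalpy_decreasing (R : realType) (e : R -> R -> R) (p a b : R) :
  eos_assumptions e -> 0 < p -> 0 < a -> a <= b ->
  enthalpy e p b <= enthalpy e p a.
Proof.
move=> he p0 a0; rewrite le_eqVlt => /orP[/eqP->//|ab].
have der x : 0 < x -> derivable (enthalpy e p) x 1.
  by move=> x0; case: (eos_ddensity (eos_C1 he) p0 x0).
apply: ltW; apply: (@ltr0_derive1_decr _ _ a b) => //.
- by move=> x; rewrite in_itv /= => /andP[ax _]; apply: der; lra.
- move=> x; rewrite in_itv /= => /andP[ax _].
  have x0 : 0 < x by lra.
  by have /andP[] := eos_causality he p0 x0.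
- apply: derivable_within_continuous => x; rewrite in_itv /= => /andP[ax _].
  by apply: der; lra.
Qed.

(** If p is the pressure of U then this is (E + p) / W, because m = (E + p) v. *)
Definition trial_root (R : realType) (U : 'cV[R]_3) (p : R) : R :=
  Num.sqrt ((U iE 0 + p) ^+ 2 - U im 0 ^+ 2).

(** The density D / W that belongs to the trial pressure p. *)
Definition trial_density (R : realType) (U : 'cV[R]_3) (p : R) : R :=
  U iD 0 * (trial_root U p / (U iE 0 + p)).

(** From E + p = rho h W^2 and D = rho W one gets h = (E + p) / (D W), which
    is [trial_root U p / D]. *)
Definition pressure_residual (R : realType) (e : R -> R -> R) (U : 'cV[R]_3)
    (p : R) : R :=
  enthalpy e p (trial_density U p) - trial_root U p / U iD 0.

Lemma trial_rootP (R : realType) (U : 'cV[R]_3) (p : R) :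
  physical U -> 0 <= p ->
  [/\ 0 < U iE 0 + p, U iD 0 < trial_root U p,
      trial_root U p ^+ 2 = (U iE 0 + p) ^+ 2 - U im 0 ^+ 2
    & trial_root U p <= U iE 0 + p].
Proof.
case=> hD; rewrite qfun_gt0E => /andP[hE hq] p0; rewrite /trial_root.
have Ep0 : 0 < U iE 0 + p by lra.
have le2 : U iE 0 ^+ 2 <= (U iE 0 + p) ^+ 2.
  by rewrite ler_pXn2r ?nnegrE //; lra.
have pos : U iD 0 ^+ 2 < (U iE 0 + p) ^+ 2 - U im 0 ^+ 2 by lra.
have nn : 0 <= (U iE 0 + p) ^+ 2 - U im 0 ^+ 2.
  by rewrite ltW // (le_lt_trans (sqr_ge0 _) pos).
split => //.
- by rewrite -(ltr_pXn2r (n := 2)) ?nnegrE ?sqrtr_ge0 ?sqr_sqrtr // ltW.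
- by rewrite sqr_sqrtr.
- rewrite -(ler_pXn2r (n := 2)) ?nnegrE ?sqrtr_ge0 ?sqr_sqrtr // ?(ltW Ep0) //.
  by rewrite gerDl oppr_le0 sqr_ge0.
Qed.

Lemma trial_density_bounds (R : realType) (U : 'cV[R]_3) (p : R) :
  physical U -> 0 <= p ->
  [/\ 0 < trial_density U 0, trial_density U 0 <= trial_density U p
    & trial_density U p <= U iD 0].
Proof.
move=> hU p0; have [D0 _] := hU.
have [a0 b0 c0 d0] := trial_rootP hU (lexx 0).
have [ap bp cp dp] := trial_rootP hU p0.
have s0 : 0 < trial_root U 0 by lra.
have sp : 0 < trial_root U p by lra.
rewrite /trial_density; split.
- by rewrite mulr_gt0 // divr_gt0.
- rewrite ler_pM2l // ler_pdivrMr // mulrAC ler_pdivlMr //.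
  rewrite -(ler_pXn2r (n := 2)) ?nnegrE
    ?mulr_ge0 ?(ltW a0, ltW ap, ltW s0, ltW sp) //.
  rewrite !exprMn c0 cp addr0.
  rewrite !mulrBl [X in _ <= X - _]mulrC lerD2l lerN2 ler_wpM2l ?sqr_ge0 //.
  by rewrite ler_pXn2r ?nnegrE ?lerDl //; lra.
- by rewrite ger_pMr // ler_pdivrMr // mul1r.
Qed.

(** The relation E + p = rho h W^2 turns m = rho h W^2 v into v = m / (E + p),
    so p alone determines W and rho; what is left is one equation, for h. *)
Lemma primitiveP (R : realType) (e : R -> R -> R) (U : 'cV[R]_3) (rho v p : R) :
  physical U ->
  is_primitive e U (rho, v, p) <->
  [/\ 0 < p, rho = trial_density U p, v = U im 0 / (U iE 0 + p)
    & pressure_residual e U p = 0].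
Proof.
move=> hU; have [D0 _] := hU; split.
- case=> r0 hv p0 UE.
  have [a0 b0 c0 d0] := trial_rootP hU (ltW p0).
  have [k k0 [kE k2]] := lorentz_inv hv.
  have [U0 U1 U2] : [/\ U iD 0 = rho / k,
     U im 0 = rho * enthalpy e p rho * k^-1 ^+ 2 * v &
      U iE 0 = rho * enthalpy e p rho * k^-1 ^+ 2 - p].
    by rewrite UE /conserved kE !vec3E.
  have X0 : U iE 0 + p = rho * enthalpy e p rho * k^-1 ^+ 2 by rewrite U2 subrK.
  have U1' : U im 0 = (U iE 0 + p) * v by rewrite U1 X0.
  have sE : trial_root U p = (U iE 0 + p) * k.
    apply/eqP; rewrite -(eqrXn2 (n := 2)) //; [|lra|by rewrite mulr_ge0 // ltW].
    by rewrite c0 exprMn k2 U1'; apply/eqP; ring.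
  have rE : rho = trial_density U p.
    rewrite /trial_density sE U0; field.
    by rewrite !gt_eqF.
  split => //; first by rewrite U1'; field; rewrite gt_eqF.
  rewrite /pressure_residual -rE sE X0 U0; field.
  by rewrite !gt_eqF.
- case=> p0 -> ->; have [a0 b0 c0 d0] := trial_rootP hU (ltW p0).
  rewrite /pressure_residual => /eqP; rewrite subr_eq0 => /eqP hh.
  have s0 : 0 < trial_root U p by lra.
  have [r0 r1 r2] := trial_density_bounds hU (ltW p0).
  have hv : `|U im 0 / (U iE 0 + p)| < 1.
    rewrite normrM normfV (gtr0_norm a0) ltr_pdivrMr // mul1r.
    rewrite -(ltr_pXn2r (n := 2)) ?nnegrE ?(ltW a0) // real_normK ?num_real //.
    by rewrite -subr_gt0 -c0 exprn_gt0.
  have kE : Num.sqrt (1 - (U im 0 / (U iE 0 + p)) ^+ 2) =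
      trial_root U p / (U iE 0 + p).
    have -> : 1 - (U im 0 / (U iE 0 + p)) ^+ 2 =
        (trial_root U p / (U iE 0 + p)) ^+ 2.
      by rewrite [RHS]exprMn c0; field; rewrite gt_eqF.
    by rewrite sqrtr_sqr gtr0_norm // divr_gt0.
  split => //; first by lra.
  apply: state_eq; rewrite /conserved kE hh !vec3E /trial_density;
    by field; rewrite !gt_eqF.
Qed.

Lemma is_derive_trial_root (R : realType) (U : 'cV[R]_3) (p : R) :
  physical U -> 0 <= p ->
  is_derive p 1 (trial_root U) ((U iE 0 + p) / trial_root U p).
Proof.
move=> hU p0; have [D0 _] := hU; have [a0 b0 c0 d0] := trial_rootP hU p0.
have s0 : 0 < trial_root U p by lra.
have dE := is_derive_add (is_derive_cst (U iE 0) p 1) (is_derive_id p 1).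
have dQ := is_derive_add (is_derive_mul dE dE)
  (is_derive_cst (- U im 0 ^+ 2) p 1).
have q0 : 0 < (U iE 0 + p) * (U iE 0 + p) - U im 0 ^+ 2.
  by rewrite -expr2 -c0 exprn_gt0.
pose Q y := (U iE 0 + y) * (U iE 0 + y) - U im 0 ^+ 2.
have dS := is_derive1_comp (g := Q) (is_derive1_sqrt q0) dQ.
have -> : trial_root U =
    Num.sqrt \o Q.
  by apply/funext => y /=; rewrite /trial_root /Q expr2.
apply: (is_derive_eq dS).
by rewrite /cst /= -expr2 -/(trial_root U p); field; rewrite gt_eqF.
Qed.

Lemma is_derive_trial_density (R : realType) (U : 'cV[R]_3) (p : R) :
  physical U -> 0 <= p ->
  is_derive p 1 (trial_density U)
    (U iD 0 * U im 0 ^+ 2 / (trial_root U p * (U iE 0 + p) ^+ 2)).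
Proof.
move=> hU p0; have [D0 _] := hU; have [a0 b0 c0 d0] := trial_rootP hU p0.
have s0 : 0 < trial_root U p by lra.
have dE := is_derive_add (is_derive_cst (U iE 0) p 1) (is_derive_id p 1).
have dr := is_derive_mul (is_derive_cst (U iD 0) p 1)
  (is_derive_mul (is_derive_trial_root hU p0)
     (is_derive_inv (lt0r_neq0 a0) dE)).
apply: (is_derive_eq dr); rewrite /cst /=.
have -> : U im 0 ^+ 2 = (U iE 0 + p) ^+ 2 - trial_root U p ^+ 2.
  by rewrite c0; ring.
by field; rewrite !gt_eqF.
Qed.

(** The derivative is h_p - 1/rho + h_rho rho', where
    rho' = D m^2 / (s (E + p)^2) and s is [trial_root U p]. Where the residual
    is nonpositive, h <= s / D, so that h rho' <= m^2 / (E + p)^2 < 1; and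
    causality gives h (h_p - 1/rho) > - h_rho > 0. Hence h times the
    derivative exceeds - h_rho (1 - h rho') > 0. *)
Lemma pressure_residual_derive (R : realType) (e : R -> R -> R) (U : 'cV[R]_3)
    (p : R) :
  eos_assumptions e -> physical U -> 0 < p ->
  exists2 d, is_derive p 1 (pressure_residual e U) d &
    pressure_residual e U p <= 0 -> 0 < d.
Proof.
move=> he hU p0; have [D0 _] := hU.
have [a0 b0 c0 d0] := trial_rootP hU (ltW p0).
have s0 : 0 < trial_root U p by lra.
have [r0' r1 _] := trial_density_bounds hU (ltW p0).
have r0 : 0 < trial_density U p by lra.
have dr := is_derive_trial_density hU (ltW p0).
have ds := is_derive_trial_root hU (ltW p0).
have de := C1_pos_chain (eos_C1 he) p0 r0 dr.
have dpr := is_derive_mul (is_derive_id p 1) (is_derive_inv (lt0r_neq0 r0) dr).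
have dsD := is_derive_mul ds (is_derive_cst (- (U iD 0)^-1) p 1).
have dall := is_derive_add
  (is_derive_add (is_derive_add (is_derive_cst (1 : R) p 1) de) dpr) dsD.
have -> : pressure_residual e U =
    fun y => 1 + e y (trial_density U y) + y / trial_density U y
             + trial_root U y * - (U iD 0)^-1.
  by apply/funext => y; rewrite /pressure_residual /enthalpy mulrN.
eexists; first exact: dall.
rewrite /cst mulrN subr_le0 -/(enthalpy e p (trial_density U p)) => hle.
have /andP[caus hr0] := eos_causality he p0 r0.
move: caus hr0; rewrite (eos_dpressure (eos_C1 he)) //.
have [_ ->] := eos_ddensity (eos_C1 he) p0 r0.
have [h1 _] := enthalpy_sqr_ge he p0 r0.
set rho := trial_density U p in r0 hle h1 *.
set h := enthalpy e p rho in hle h1 *.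
set ep := dpressure e p rho; set er := ddensity e p rho.
set s := trial_root U p in s0 b0 c0 d0 hle *.
have rhoE : rho^-1 = (U iE 0 + p) / (U iD 0 * s).
  by rewrite /rho /trial_density -/s; field; rewrite !gt_eqF.
set dr' := _ / (_ * _ ^+ 2).
move=> caus hr0.
have -> : 0 + (ep + er * dr') + (1 / rho + p * - (dr' / rho ^+ 2)) +
    ((U iE 0 + p) / s * - (U iD 0)^-1 + s * 0) =
    (ep + (er - p / rho ^+ 2) * dr').
  have -> : (U iE 0 + p) / s * - (U iD 0)^-1 = - rho^-1.
    by rewrite rhoE; field; rewrite !gt_eqF.
  by ring.
have dr0 : 0 <= dr'.
  by apply: divr_ge0; rewrite mulr_ge0 ?sqr_ge0 // ltW.
have dr1 : h * dr' < 1.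
  apply: (@le_lt_trans _ _ (s / U iD 0 * dr')); first by rewrite ler_wpM2r.
  have -> : s / U iD 0 * dr' = U im 0 ^+ 2 / (U iE 0 + p) ^+ 2.
    by rewrite /dr'; field; rewrite !gt_eqF.
  by rewrite ltr_pdivrMr ?exprn_gt0 // mul1r -subr_gt0 -c0 exprn_gt0.
have hep : - (er - p / rho ^+ 2) < h * ep.
  move: caus; have -> : h * (rho^-1 - (ep + rho^-1)) = - (h * ep) by ring.
  by rewrite ltrNl.
have : 0 < h * (ep + (er - p / rho ^+ 2) * dr').
  set hr := er - p / rho ^+ 2 in hr0 hep *.
  have : 0 < - hr * (1 - h * dr') by rewrite mulr_gt0 //; lra.
  have -> : - hr * (1 - h * dr') = - hr + h * (hr * dr') by ring.
  rewrite mulrDr; lra.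
by rewrite pmulr_rgt0 //; lra.
Qed.

Lemma pressure_residual_continuous (R : realType) (e : R -> R -> R)
    (U : 'cV[R]_3) (a b : R) :
  eos_assumptions e -> physical U -> 0 < a ->
  {within `[a, b], continuous (pressure_residual e U)}.
Proof.
move=> he hU a0; apply: derivable_within_continuous => x.
rewrite in_itv /= => /andP[ax _].
by have [|d [dx _] _] := pressure_residual_derive he hU (p := x); first lra.
Qed.

(** The residual increases through the zero b, so it is negative just before
    b, and its minimum on [a, b] is negative and attained inside. At such a
    point the derivative is both zero and positive. *)
Lemma pressure_residual_uniq (R : realType) (e : R -> R -> R) (U : 'cV[R]_3)
    (a b : R) :
  eos_assumptions e -> physical U -> 0 < a -> a < b ->
  pressure_residual e U a = 0 -> pressure_residual e U b = 0 -> False.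
Proof.
move=> he hU a0 ab fa fb; set f := pressure_residual e U in fa fb.
have b0 : 0 < b by lra.
have cont := @pressure_residual_continuous _ e U a b he hU a0.
have [t /andP[ta tb] ft] : exists2 t, a < t < b & f t < 0.
  have [d [dd dE] /(_ (eq_ind_r (fun x => x <= 0) (lexx 0) fb)) d0] :=
    pressure_residual_derive he hU b0.
  have cv : h^-1 *: (f (h *: 1 + b) - f b) @[h --> 0^'] --> d by rewrite -dE.
  have /cvgrPdist_lt/(_ _ d0) := cv.
  rewrite /dnbhs /within /= => /nbhs_ballP[del /= del0 hdel].
  (* halving the minimum keeps h + b strictly inside ]a, b[ *)
  set h := - (Num.min del (b - a) / 2).
  have m0 : 0 < Num.min del (b - a) by rewrite lt_min del0 subr_gt0.
  have [m1 m2] : Num.min del (b - a) <= del /\ Num.min del (b - a) <= b - a.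
    by rewrite !ge_min !lexx orbT.
  have h0 : h < 0 by rewrite /h; lra.
  exists (h + b); first by apply/andP; rewrite /h; split; lra.
  have := hdel h; rewrite /ball /= sub0r normrN (ltr0_norm h0) scaler1 fb subr0.
  have hd : - h < del by rewrite /h; lra.
  move=> /(_ hd (ltr0_neq0 h0)).
  rewrite ltr_norml => /andP[_ H].
  have : 0 < h^-1 * f (h + b) by move: H; rewrite /GRing.scale /=; lra.
  by rewrite nmulr_rgt0 // invr_lt0.
have [c cab cmin] := EVT_min (ltW ab) cont.
have fc : f c < 0.
  by apply: le_lt_trans ft; apply: cmin; rewrite in_itv /= !ltW.
have ac : a < c.
  move: cab; rewrite in_itv /= le_eqVlt => /andP[/orP[/eqP ac|//] _].
  by move: fc; rewrite -ac fa ltxx.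
have cb : c < b.
  move: cab; rewrite in_itv /= => /andP[_].
  rewrite le_eqVlt => /orP[/eqP bc|//].
  by move: fc; rewrite bc fb ltxx.
have c0 : 0 < c by lra.
have [d dc dpos] := pressure_residual_derive he hU c0.
have d0 := dpos (ltW fc).
have := @derive1_at_min _ f a b c (ltW ab).
case.
- move=> x; rewrite in_itv /= => /andP[ax _].
  by have [|? []] := pressure_residual_derive he hU (p := x); first lra.
- by rewrite in_itv /= ac.
- move=> x; rewrite in_itv /= => /andP[ax xb]; apply: cmin.
  by rewrite in_itv /= !ltW.
- move=> _ D0; case: dc => _ Dd.
  by move: d0; rewrite -Dd D0 ltxx.
Qed.

(** Since h decreases in the density and the trial density lies between its
    value rho0 at p = 0 and D, the residual is at most h(p, rho0) - s(0) / D,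
    which is negative for small p because q(U) > 0 means s(0) > D; and it is
    at least 1 + e(p, D) - E / D, which is positive for large p. *)
Lemma pressure_residual_root (R : realType) (e : R -> R -> R) (U : 'cV[R]_3) :
  eos_assumptions e -> physical U ->
  exists2 p, 0 < p & pressure_residual e U p = 0.
Proof.
move=> he hU; have [D0 _] := hU.
have [r0 _ _] := trial_density_bounds hU (lexx 0).
set rho0 := trial_density U 0 in r0.
have [_ sD s2 _] := trial_rootP hU (lexx 0).
(* half of this gap bounds e, the other half p / rho0 *)
set gap := trial_root U 0 / U iD 0 - 1.
have gap0 : 0 < gap by rewrite subr_gt0 ltr_pdivlMr // mul1r.
have [p1 p10 f1] : exists2 p, 0 < p & pressure_residual e U p < 0.
  have cv := eos_lim_0 he r0.
  have g2 : 0 < gap / 2 by lra.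
  have /cvgrPdist_lt/(_ _ g2) cv' := cv.
  have : \forall p \near 0^'+, 0 < p /\ pressure_residual e U p < 0.
    near=> p.
    have p0 : 0 < p by [].
    have hp : p < rho0 * gap / 2.
      by near: p; apply: nbhs_right_lt; rewrite divr_gt0 // mulr_gt0.
    have he0 : `|0 - e p rho0| < gap / 2 by near: p; exact: cv'.
    split => //.
    have [_ rr _] := trial_density_bounds hU (ltW p0).
    have := enthalpy_decreasing he p0 r0 rr.
    have ss : trial_root U 0 / U iD 0 <= trial_root U p / U iD 0.
      rewrite ler_pM2r ?invr_gt0 //.
      have [a0 b0 c0 _] := trial_rootP hU (ltW p0).
      rewrite -(ler_pXn2r (n := 2)) ?nnegrE //; [|lra|lra].
      have [E0 _ _ _] := trial_rootP hU (lexx 0).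
      by rewrite s2 c0 addr0 lerB // ler_pXn2r ?nnegrE //; lra.
    rewrite /pressure_residual {2}/enthalpy -/rho0.
    have : p / rho0 < gap / 2 by rewrite ltr_pdivrMr //; lra.
    move: he0; rewrite sub0r normrN ltr_norml => /andP[_].
    move: ss; rewrite /gap; lra.
  by move=> /filter_ex[p []]; exists p.
have [p2 p12 f2] : exists2 p, p1 < p & 0 < pressure_residual e U p.
  have /cvgryPgt/(_ (U iE 0 / U iD 0)) cv := eos_lim_pinfty he D0.
  have : \forall p \near +oo, p1 < p /\ 0 < pressure_residual e U p.
    near=> p.
    have hp : p1 < p by near: p; apply: nbhs_pinfty_gt; rewrite num_real.
    have he1 : U iE 0 / U iD 0 < e p (U iD 0) by near: p; exact: cv.
    split => //; have p0 : 0 < p by lra.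
    have [q0 r1 r2] := trial_density_bounds hU (ltW p0).
    have rp0 : 0 < trial_density U p by lra.
    have := enthalpy_decreasing he p0 rp0 r2.
    have [a0 b0 c0 d0] := trial_rootP hU (ltW p0).
    have : trial_root U p / U iD 0 <= U iE 0 / U iD 0 + p / U iD 0.
      by rewrite -mulrDl ler_pM2r ?invr_gt0.
    rewrite /pressure_residual {1}/enthalpy; lra.
  by move=> /filter_ex[p []]; exists p.
have cont := @pressure_residual_continuous _ e U p1 p2 he hU p10.
have [|p] := @IVT _ (pressure_residual e U) p1 p2 0 (ltW p12) cont.
  by rewrite ge_min le_max (ltW f1) (ltW f2) orbT.
by rewrite in_itv /= => /andP[pp _] fp; exists p => //; lra.
Unshelve. all: by end_near.
Qed.

Lemma admissibleP (R : realType) (e : R -> R -> R) (U : 'cV[R]_3) :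
  eos_assumptions e -> admissible e U <-> physical U.
Proof.
move=> he; split; first by case=> w [hw _] _; exact: primitive_physical hw.
move=> hU; have [p p0 fp] := pressure_residual_root he hU.
have hw : is_primitive e U (trial_density U p, U im 0 / (U iE 0 + p), p).
  by apply/primitiveP.
exists (trial_density U p, U im 0 / (U iE 0 + p), p); last first.
  by case: hw => ? _ _ _; exact: eos_gt0.
split => // -[[rho v] p'] /(primitiveP _ _ _ _ hU)[p'0 -> -> fp'].
suff -> : p' = p by [].
apply/eqP; apply/negPn/negP; rewrite neq_lt => /orP[] lt.
- exact: pressure_residual_uniq he hU p'0 lt fp' fp.
- exact: pressure_residual_uniq he hU p0 lt fp fp'.
Qed.

Local Close Scope classical_set_scope.

(** * The limiter *)

Lemma min_on_le (R : realType) (s : seq R) (f : R -> R) (x : R) :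
  x \in s -> min_on s f <= f x.
Proof.
rewrite /min_on; elim: s (f (head 0 s)) => // y s IH z.
rewrite inE big_cons ge_min => /orP[/eqP->|/IH->]; first by rewrite lexx.
by rewrite orbT.
Qed.

Lemma vevalE (R : realType) (P : vpoly R) (x : R) i : veval P x i 0 = (P i).[x].
Proof. by rewrite mxE. Qed.

Lemma averageE (R : realType) (dx xc : R) (P : vpoly R) i :
  average dx xc P i 0 = dx^-1 * polyint (xc - dx / 2) (xc + dx / 2) (P i).
Proof. by rewrite !mxE. Qed.

(** The limiter applies such a contraction towards the cell average twice. *)
Definition contract (R : realType) (theta c : R) (p : {poly R}) : {poly R} :=
  theta *: (p - c%:P) + c%:P.

Lemma horner_contract (R : realType) (theta c x : R) (p : {poly R}) :
  (contract theta c p).[x] = theta * p.[x] + (1 - theta) * c.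
Proof. by rewrite !(hornerD, hornerN, hornerZ, hornerC); ring. Qed.

Lemma size_contract (R : realType) (theta c : R) (p : {poly R}) (n : nat) :
  (size p <= n.+1)%N -> (size (contract theta c p) <= n.+1)%N.
Proof.
move=> hp; have hc : (size c%:P <= n.+1)%N.
  by rewrite size_polyC (leq_trans (leq_b1 _)).
apply: (leq_trans (size_polyD _ _)); rewrite geq_max hc andbT.
apply: (leq_trans (size_scale_leq _ _)); apply: (leq_trans (size_polyD _ _)).
by rewrite size_polyN geq_max hp hc.
Qed.

Lemma polyint_contract (R : realType) (dx xc theta : R) (p : {poly R}) :
  0 < dx -> let c := dx^-1 * polyint (xc - dx / 2) (xc + dx / 2) p in
  dx^-1 * polyint (xc - dx / 2) (xc + dx / 2) (contract theta c p) = c.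
Proof.
move=> dx0 c; have lt : xc - dx / 2 < xc + dx / 2 by lra.
rewrite /contract polyintD // polyintZ // -polyCN polyintD // !polyintC //.
by rewrite /c; field; rewrite gt_eqF.
Qed.

(** Whatever the values of the contraction factors, the limiter acts
    componentwise by contractions towards the average. This is enough for its
    linear properties: it keeps averages and degrees. *)
Lemma pcp_limiterP (R : realType) (eps : R) (S : seq R) (Ubar : 'cV[R]_3)
    (P : vpoly R) :
  exists th1 th2 : R, forall i, pcp_limiter eps S Ubar P i =
    contract th2 (Ubar i 0)
      (contract (if i == iD then th1 else 1) (Ubar i 0) (P i)).
Proof.
have contract1 c p : contract 1 c p = p :> {poly R}.
  by rewrite /contract scale1r subrK.
have [th1 h1] : exists th1 : R, forall i,
    limit_density eps S Ubar P i =
    contract (if i == iD then th1 else 1) (Ubar i 0) (P i).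
  rewrite /limit_density; set th := (_ - _) / _.
  exists (if min_on S (fun x => (P iD).[x]) < eps then th else 1) => i.
  by case: eqP => [->|_] /=; case: (min_on _ _ < eps) => /=; rewrite ?contract1.
pose Q := limit_density eps S Ubar P.
pose qmin := min_on S (fun x => qfun (veval Q x)).
exists th1, (if qmin < eps then (qfun Ubar - eps) / (qfun Ubar - qmin) else 1).
move=> i.
rewrite -h1 /pcp_limiter /limit_q -/Q; by case: ifP.
Qed.

Lemma cell_limited_average (R : realType) (dx xc : R) gq lq (P Pt : vpoly R) :
  0 < dx -> cell_limited dx gq lq xc P Pt -> average dx xc Pt = average dx xc P.
Proof.
move=> dx0 [eps [_ ->]].
have [th1 [th2 E]] :=
  pcp_limiterP eps (limiter_nodes dx gq lq xc) (average dx xc P) P.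
apply/colP => i; rewrite averageE E.
pose th := if i == iD then th1 else 1; rewrite -/th.
have h1 := polyint_contract xc th (P i) dx0; rewrite /= -averageE in h1.
have h2 :=
  polyint_contract xc th2 (contract th (average dx xc P i 0) (P i)) dx0.
by rewrite /= h1 in h2.
Qed.

Lemma cell_limited_size (R : realType) (dx xc : R) gq lq (P Pt : vpoly R) K i :
  cell_limited dx gq lq xc P Pt -> (size (P i) <= K.+1)%N ->
  (size (Pt i) <= K.+1)%N.
Proof.
move=> [eps [_ ->]] hP.
have [th1 [th2 ->]] :=
  pcp_limiterP eps (limiter_nodes dx gq lq xc) (average dx xc P) P.
by do 2 apply: size_contract.
Qed.

(** The contraction factor is chosen so as to move the minimum exactly to eps. *)
Lemma limiter_theta (R : realType) (a m eps : R) : eps <= a -> m < eps ->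
  let th := (a - eps) / (a - m) in
  0 <= th <= 1 /\ th * m + (1 - th) * a = eps.
Proof.
move=> ea me th; have am : 0 < a - m by lra.
split.
  apply/andP; split; first by apply: divr_ge0; lra.
  by rewrite ler_pdivrMr // mul1r; lra.
by rewrite /th; field; rewrite gt_eqF.
Qed.

(** The first contraction lifts the density to at least eps at every node; the
    second one is a convex combination with the average, which keeps that
    bound and, by concavity, lifts q to at least eps. *)
Lemma pcp_limiter_physical (R : realType) (eps : R) (S : seq R)
    (Ubar : 'cV[R]_3) (P : vpoly R) (x : R) :
  0 < eps -> eps <= Ubar iD 0 -> eps <= qfun Ubar -> x \in S ->
  physical (veval (pcp_limiter eps S Ubar P) x).
Proof.
move=> e0 eD eq xS.
set Q := limit_density eps S Ubar P.
have QD : eps <= (Q iD).[x].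
  have := min_on_le (fun x => (P iD).[x]) xS.
  rewrite /Q /limit_density eqxx /=.
  case: ltP => [me|em] mle; last exact: le_trans mle.
  have [/andP[t0 _] tE] := limiter_theta eD me.
  by rewrite horner_contract -{1}tE lerD2r ler_wpM2l.
have := min_on_le (fun x => qfun (veval Q x)) xS.
rewrite /pcp_limiter /limit_q -/Q; case: ltP => [me|em] mle; last first.
  split; first by rewrite vevalE; exact: lt_le_trans QD.
  exact/(lt_le_trans e0)/(le_trans em).
have [/andP[t0 t1] tE] := limiter_theta eq me.
set th := _ / _ in t0 t1 tE *.
have -> : veval (fun i => th *: (Q i - (Ubar i 0)%:P) + (Ubar i 0)%:P) x =
    th *: veval Q x + (1 - th) *: Ubar.
  by apply/colP => i; rewrite vevalE horner_contract !mxE.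
split; last first.
  apply: (lt_le_trans e0); apply: le_trans (qfunD _ _).
  rewrite !qfunZ ?subr_ge0 // -{1}tE lerD2r.
  exact: ler_wpM2l.
rewrite !mxE; apply: (lt_le_trans e0).
have -> : eps = th * eps + (1 - th) * eps by ring.
by apply: lerD; apply: ler_wpM2l => //; rewrite subr_ge0.
Qed.

Lemma cell_limited_physical (R : realType) (dx xc : R) gq lq
    (P Pt : vpoly R) x :
  cell_limited dx gq lq xc P Pt -> physical (average dx xc P) ->
  x \in limiter_nodes dx gq lq xc -> physical (veval Pt x).
Proof.
move=> [eps [heps ->]] [hD hq]; have [? ? ?] := heps hD hq.
exact: pcp_limiter_physical.
Qed.

(** * One forward Euler step on a cell *)

Lemma polyint_half_cell (R : realType) (lq : quad_rule R) (dx hc : R)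
    (p : {poly R}) :
  is_gauss_lobatto lq -> 0 < dx -> (size p + 2 <= 2 * qsize lq)%N ->
  polyint (hc - dx / 4) (hc + dx / 4) p =
  dx / 2 * \sum_(1 <= a < (qsize lq).+1)
    qweight lq a * p.[half_node dx hc (qnode lq a)].
Proof.
case=> _ _ exact_ dx0 sp; have k0 : 0 < dx / 4 by lra.
have sq : (size (p \Po (hc%:P + (dx / 4) *: 'X)) + 2 <= 2 * qsize lq)%N.
  apply: leq_trans sp; rewrite leq_add2r.
  have [->|p0] := eqVneq p 0; first by rewrite comp_poly0.
  apply: (leq_trans (size_comp_poly_leq _ _)).
  have : (size (hc%:P + (dx / 4) *: 'X : {poly R})%R <= 2)%N.
    apply: (leq_trans (size_polyD _ _)); rewrite geq_max size_polyC.
    rewrite (leq_trans (leq_b1 _)) //=.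
    by apply: (leq_trans (size_scale_leq _ _)); rewrite size_polyX.
  by move: p0; rewrite -size_poly_gt0; nia.
have := exact_ _ sq; rewrite polyint_affine // /quad_sum => E.
have -> : \sum_(1 <= a < (qsize lq).+1)
    qweight lq a * p.[half_node dx hc (qnode lq a)] =
    (dx / 4)^-1 * polyint (hc - dx / 4) (hc + dx / 4) p / 2.
  rewrite -E; apply: eq_bigr => a _; rewrite horner_comp.
  by rewrite !(hornerD, hornerZ, hornerC, hornerX).
by field; rewrite gt_eqF.
Qed.

Lemma flux_weakly_physical (R : realType) (e : R -> R -> R) (U : 'cV[R]_3)
    (t : R) :
  eos_assumptions e -> physical U -> `|t| <= 1 ->
  weakly_physical (U + t *: flux e U).
Proof.
move=> he hU ht; rewrite /flux.
have : is_primitive e U (primitive e U).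
  have [w [hw _] _] : admissible e U by apply/admissibleP.
  have ex : exists w, is_primitive e U w by exists w.
  exact: (@xgetPex _ (0, 0, 0) [set w | is_primitive e U w]%classic ex).
case: (primitive e U) => [[rho v] p] hw.
exact: physical_add_flux he hw ht.
Qed.

Lemma weakly_physical_sum (R : realType) (m n : nat) (w : nat -> R)
    (F : nat -> 'cV[R]_3) :
  (forall a, (m <= a < n)%N -> 0 <= w a /\ weakly_physical (F a)) ->
  weakly_physical (\sum_(m <= a < n) w a *: F a).
Proof.
move=> h; rewrite big_nat_cond.
apply: big_ind => [||a]; [exact: weakly_physical0|exact: weakly_physicalD|].
by rewrite andbT => /h[w0 F0]; exact: weakly_physicalZ.
Qed.

(** The scheme tested with w = 1: the volume flux terms disappear together
    with the derivative of w. *)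
Lemma cell_rhs_average (R : realType) (e : R -> R -> R) (K : nat)
    (dx tau : R) (gq lq : quad_rule R) (xc s : R) (Uown Ul Ur Rhs : vpoly R) :
  is_gauss_lobatto lq -> 0 < dx -> 0 < tau ->
  (forall i, size (Ul i) + 2 <= 2 * qsize lq)%N ->
  (forall i, size (Ur i) + 2 <= 2 * qsize lq)%N ->
  cell_rhs e K dx tau gq xc Uown Ul Ur Rhs ->
  average dx xc (Uown + s *: Rhs) =
    (1 - s / tau) *: average dx xc Uown
    + (s / tau / 2) *: (\sum_(1 <= a < (qsize lq).+1)
        qweight lq a *: veval Ul (half_node dx (xc - dx / 4) (qnode lq a)))
    + (s / tau / 2) *: (\sum_(1 <= a < (qsize lq).+1)
        qweight lq a *: veval Ur (half_node dx (xc + dx / 4) (qnode lq a)))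
    + (s / dx) *: (flux e (veval Ul (xc - dx / 2))
                   - flux e (veval Ur (xc + dx / 2))).
Proof.
move=> hlq dx0 t0 sl sr hc.
have /hc : (size (1%:P : {poly R}) <= K.+1)%N by rewrite size_polyC oner_eq0.
have vmul1 P : vmul P 1%:P = P :> vpoly R.
  by apply/funext => i; rewrite /vmul polyC1 mulr1.
rewrite !vmul1 big1 ?scaler0 ?addr0 => [|a _]; last first.
  by rewrite /= derivC !horner0 !scale0r addr0 scaler0.
rewrite !hornerC !scale1r => E.
have a1 : xc - dx / 2 < xc by lra.
have a2 : xc < xc + dx / 2 by lra.
have a3 : xc - dx / 2 < xc + dx / 2 by lra.
have eL : xc - dx / 2 = xc - dx / 4 - dx / 4 by field.
have eM : xc = xc - dx / 4 + dx / 4 by field.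
have eM' : xc = xc + dx / 4 - dx / 4 by field.
have eR : xc + dx / 2 = xc + dx / 4 + dx / 4 by field.
apply/colP => i; move/colP/(_ i): E.
rewrite [LHS in _ -> LHS = _]averageE.
rewrite !mxE !summxE.
have -> : (Uown + s *: Rhs) i = Uown i + s *: Rhs i by [].
have -> : (Ul - Uown) i = Ul i + (-1) *: Uown i by rewrite scaleN1r.
have -> : (Ur - Uown) i = Ur i + (-1) *: Uown i by rewrite scaleN1r.
rewrite !polyintD // !polyintZ // => ->.
rewrite (polyint_chasles (Uown i) a1 a2).
have -> : polyint (xc - dx / 2) xc (Ul i) =
    polyint (xc - dx / 4 - dx / 4) (xc - dx / 4 + dx / 4) (Ul i).
  by rewrite -eL -[in RHS]eM.
have -> : polyint xc (xc + dx / 2) (Ur i) =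
    polyint (xc + dx / 4 - dx / 4) (xc + dx / 4 + dx / 4) (Ur i).
  by rewrite -eM' -[in RHS]eR.
rewrite !(polyint_half_cell _ hlq) //.
have sumE (P : vpoly R) (y : nat -> R) :
    \sum_(1 <= a < (qsize lq).+1) (qweight lq a *: veval P (y a)) i 0 =
    \sum_(1 <= a < (qsize lq).+1) qweight lq a * (P i).[y a].
  by apply: eq_bigr => a _; rewrite !mxE.
rewrite !sumE; field.
by rewrite !gt_eqF.
Qed.

(** Splitting off the first node of the left half and the last node of the
    right half leaves, besides the merged point values and fluxes, a term of
    the open cone: the last node of the left half, which is the center of the
    cell. *)
Lemma euler_cell (R : realType) (e : R -> R -> R) (K : nat)
    (dx tau : R) (gq lq : quad_rule R) (xc s : R) (Uown Ul Ur Rhs : vpoly R) :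
  eos_assumptions e -> is_gauss_lobatto lq -> 0 < dx -> 0 < tau ->
  (forall i, size (Ul i) + 2 <= 2 * qsize lq)%N ->
  (forall i, size (Ur i) + 2 <= 2 * qsize lq)%N ->
  cell_rhs e K dx tau gq xc Uown Ul Ur Rhs ->
  0 < s <= tau -> tau <= qweight lq 1 * dx / 2 ->
  physical (average dx xc Uown) ->
  (forall x, x \in rule_nodes dx (xc - dx / 4) lq -> physical (veval Ul x)) ->
  (forall x, x \in rule_nodes dx (xc + dx / 4) lq -> physical (veval Ur x)) ->
  physical (average dx xc (Uown + s *: Rhs)).
Proof.
move=> he hlq dx0 t0 sl sr hc /andP[s0 st] cfl hU hl hr.
rewrite (cell_rhs_average _ hlq dx0 t0 sl sr hc).
have w1L := lobatto_first_le_last hlq.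
case: hlq => -[_ wpos _] [L2 [n1 nL]] _.
set L := qsize lq in L2 nL wpos w1L hl hr *.
have L1 : (1 <= L < L.+1)%N by lia.
have one1 : (1 <= 1 < L.+1)%N by lia.
have sub2 a : (2 <= a < L)%N -> (1 <= a < L.+1)%N by lia.
have sub1 a : (1 <= a < L)%N -> (1 <= a < L.+1)%N by lia.
have L1' : (1 < L.+1)%N by lia.
have L0 : (0 < L)%N by lia.
pose yl a := half_node dx (xc - dx / 4) (qnode lq a).
pose yr a := half_node dx (xc + dx / 4) (qnode lq a).
have pl a : (1 <= a < L.+1)%N -> physical (veval Ul (yl a)).
  by move=> ha; apply: hl; apply/mapP; exists a => //; rewrite mem_iota.
have pr a : (1 <= a < L.+1)%N -> physical (veval Ur (yr a)).
  by move=> ha; apply: hr; apply/mapP; exists a => //; rewrite mem_iota.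
have yl1 : yl 1%N = xc - dx / 2 by rewrite /yl n1 /half_node; field.
have yrL : yr L = xc + dx / 2 by rewrite /yr nL /half_node; field.
have w0 a : (1 <= a < L.+1)%N -> 0 < qweight lq a by exact: wpos.
have w10 : 0 < qweight lq 1 by exact: w0.
have wL0 : 0 < qweight lq L by exact: w0.
set th := s / tau; have th0 : 0 < th by rewrite divr_gt0.
have th1 : th <= 1 by rewrite ler_pdivrMr // mul1r.
have -> : \sum_(1 <= a < L.+1) qweight lq a *: veval Ul (yl a) =
    qweight lq 1 *: veval Ul (yl 1%N) +
    (\sum_(2 <= a < L) qweight lq a *: veval Ul (yl a)
     + qweight lq L *: veval Ul (yl L)).
  by rewrite big_ltn // big_nat_recr.
have -> : \sum_(1 <= a < L.+1) qweight lq a *: veval Ur (yr a) =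
    \sum_(1 <= a < L) qweight lq a *: veval Ur (yr a)
    + qweight lq L *: veval Ur (yr L).
  by rewrite big_nat_recr.
rewrite yl1 yrL.
set Sl := \sum_(2 <= a < L) _; set Sr := \sum_(1 <= a < L) _.
have wSl : weakly_physical Sl.
  apply: weakly_physical_sum => a /sub2 ha.
  by split; [exact/ltW/w0|exact/physicalW/pl].
have wSr : weakly_physical Sr.
  apply: weakly_physical_sum => a /sub1 ha.
  by split; [exact/ltW/w0|exact/physicalW/pr].
set Fl := flux e _; set Fr := flux e _.
(* A1 and AL merge the fluxes at the ends of the cell with the values there *)
pose A1 := veval Ul (xc - dx / 2) + (2 * tau / (dx * qweight lq 1)) *: Fl.
pose AL := veval Ur (xc + dx / 2) + (- (2 * tau / (dx * qweight lq L))) *: Fr.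
rewrite [X in physical X](_ : _ = (th / 2 * qweight lq L) *: veval Ul (yl L) +
   ((1 - th) *: average dx xc Uown + (th / 2) *: Sl + (th / 2) *: Sr +
    (th / 2 * qweight lq 1) *: A1 + (th / 2 * qweight lq L) *: AL)); last first.
  apply/colP => i; rewrite /A1 /AL !mxE /th; field.
  by rewrite !gt_eqF.
have lam w : qweight lq 1 <= w -> 0 < w -> `|2 * tau / (dx * w)| <= 1.
  move=> ww wp; rewrite ger0_norm; last by rewrite divr_ge0 // mulr_ge0 // ltW.
  rewrite ler_pdivrMr ?mulr_gt0 // mul1r.
  have : qweight lq 1 * dx <= w * dx by rewrite ler_pM2r.
  lra.
have pth : 0 < th / 2 by lra.
apply: physical_add_weakly.
  by apply: physicalZ; [exact: mulr_gt0|exact: pl].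
have pxl : physical (veval Ul (xc - dx / 2)) by rewrite -yl1; exact: pl.
have pxr : physical (veval Ur (xc + dx / 2)) by rewrite -yrL; exact: pr.
have g0 : 0 <= 1 - th by rewrite subr_ge0.
have g1 := ltW (mulr_gt0 pth w10); have gL := ltW (mulr_gt0 pth wL0).
have g2 := ltW pth.
do ?apply: weakly_physicalD; apply: weakly_physicalZ => //.
- exact: physicalW.
- by rewrite /A1; apply: flux_weakly_physical => //; exact: lam.
- by rewrite /AL; apply: flux_weakly_physical => //; rewrite normrN; exact: lam.
Qed.

(** * The fully discrete methods *)

Lemma average_comb (R : realType) (dx xc a b : R) (P Q : vpoly R) : 0 < dx ->
  average dx xc (a *: P + b *: Q) = a *: average dx xc P + b *: average dx xc Q.
Proof.
move=> dx0; have lt : xc - dx / 2 < xc + dx / 2 by lra.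
apply/colP => i; rewrite [RHS]mxE [in RHS]mxE [X in _ = _ + X]mxE !averageE.
rewrite (_ : (a *: P + b *: Q) i = a *: P i + b *: Q i) //.
by rewrite polyintD // !polyintZ //; ring.
Qed.

Lemma averages_admissible_comb (R : realType) (e : R -> R -> R) (x0 dx a b : R)
    (U V : dg_pair R) :
  eos_assumptions e -> 0 < dx -> 0 < a -> 0 < b ->
  averages_admissible e x0 dx U -> averages_admissible e x0 dx V ->
  averages_admissible e x0 dx (a *: U + b *: V).
Proof.
move=> he dx0 a0 b0 hU hV j; have [UI UJ] := hU j; have [VI VJ] := hV j.
split; apply/(admissibleP _ he).
- rewrite (_ : (a *: U + b *: V).1 j = a *: U.1 j + b *: V.1 j) //.
  rewrite average_comb //.
  by apply: physicalD; apply: physicalZ => //; apply/(admissibleP _ he).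
- rewrite (_ : (a *: U + b *: V).2 j = a *: U.2 j + b *: V.2 j) //.
  rewrite average_comb //.
  by apply: physicalD; apply: physicalZ => //; apply/(admissibleP _ he).
Qed.

Lemma dg_space_comb (R : realType) (K : nat) (a b : R) (U V : dg_pair R) :
  dg_space K U -> dg_space K V -> dg_space K (a *: U + b *: V).
Proof.
move=> hU hV j i; have [UI UJ] := hU j i; have [VI VJ] := hV j i.
have comb (p q : {poly R}) : (size p <= K.+1)%N -> (size q <= K.+1)%N ->
    (size (a *: p + b *: q)%R <= K.+1)%N.
  move=> hp hq; apply: (leq_trans (size_polyD _ _)); rewrite geq_max.
  by rewrite !(leq_trans (size_scale_leq _ _)).
by split; exact: comb.
Qed.

Lemma dg_space_step (R : realType) (K : nat) (s : R) (U V : dg_pair R) :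
  dg_space K U -> dg_space K V -> dg_space K (U + s *: V).
Proof. by move=> hU hV; rewrite -[U]scale1r; exact: dg_space_comb. Qed.

Lemma is_limited_dg_space (R : realType) (K : nat) (x0 dx : R) gq lq
    (U Ut : dg_pair R) :
  is_limited x0 dx gq lq U Ut -> dg_space K U -> dg_space K Ut.
Proof.
move=> hl hU j i; have [lI lJ] := hl j; have [UI UJ] := hU j i.
by split; [exact: cell_limited_size lI UI|exact: cell_limited_size lJ UJ].
Qed.

Lemma is_limited_averages (R : realType) (e : R -> R -> R) (x0 dx : R) gq lq
    (U Ut : dg_pair R) :
  0 < dx -> is_limited x0 dx gq lq U Ut ->
  averages_admissible e x0 dx U -> averages_admissible e x0 dx Ut.
Proof.
move=> dx0 hl hU j; have [lI lJ] := hl j.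
rewrite (cell_limited_average dx0 lI) (cell_limited_average dx0 lJ).
exact: hU.
Qed.

Lemma is_limited_nodes (R : realType) (e : R -> R -> R) (x0 dx : R) gq lq
    (U Ut : dg_pair R) :
  eos_assumptions e -> is_limited x0 dx gq lq U Ut ->
  averages_admissible e x0 dx U -> nodes_admissible e x0 dx gq lq Ut.
Proof.
move=> he hl hU j; have [lI lJ] := hl j; have [UI UJ] := hU j.
split=> x xS; apply/(admissibleP _ he).
- by apply: (cell_limited_physical lI _ xS); exact/(admissibleP _ he).
- by apply: (cell_limited_physical lJ _ xS); exact/(admissibleP _ he).
Qed.

(** The bound on tau is the CFL condition solved for tau_max: the time step
    cancels, so the same bound serves steps of different lengths s. *)
Lemma euler_step (R : realType) (e : R -> R -> R) (K : nat) (x0 dx tau : R)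
    (gq lq : quad_rule R) (s : R) (V LV : dg_pair R) :
  eos_assumptions e -> 0 < dx -> 0 < tau ->
  is_gauss_lobatto lq -> (K + 3 < 2 * qsize lq)%N ->
  tau <= qweight lq 1 * dx / 2 -> 0 < s <= tau ->
  dg_space K V -> averages_admissible e x0 dx V ->
  nodes_admissible e x0 dx gq lq V -> is_dg_operator e K x0 dx tau gq V LV ->
  averages_admissible e x0 dx (V + s *: LV).
Proof.
move=> he dx0 t0 hlq hL cfl hs hV aV nV [_ op] j.
have [opI opJ] := op j; have [aI aJ] := aV j.
have sI k i : (size (V.1 k i) + 2 <= 2 * qsize lq)%N by have [] := hV k i; lia.
have sJ k i : (size (V.2 k i) + 2 <= 2 * qsize lq)%N by have [] := hV k i; lia.
have nI k x : x \in limiter_nodes dx gq lq (centerI x0 dx k) ->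
    physical (veval (V.1 k) x).
  by move=> hx; apply/(admissibleP _ he); have [+ _] := nV k; exact.
have nJ k x : x \in limiter_nodes dx gq lq (centerJ x0 dx k) ->
    physical (veval (V.2 k) x).
  by move=> hx; apply/(admissibleP _ he); have [_ +] := nV k; exact.
have left_half xc x : x \in rule_nodes dx (xc - dx / 4) lq ->
    x \in limiter_nodes dx gq lq xc.
  by rewrite /limiter_nodes !mem_cat => ->; rewrite !orbT.
have right_half xc x : x \in rule_nodes dx (xc + dx / 4) lq ->
    x \in limiter_nodes dx gq lq xc.
  by rewrite /limiter_nodes !mem_cat => ->; rewrite !orbT.
split; apply/(admissibleP _ he).
- apply: (euler_cell he hlq dx0 t0 _ _ opI hs cfl) => //.
  + exact/(admissibleP _ he).
  + move=> x hx; apply/nJ/right_half; move: hx.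
    by congr (_ \in rule_nodes _ _ _); rewrite /centerJ /centerI intrB; field.
  + move=> x hx; apply/nJ/left_half; move: hx.
    by congr (_ \in rule_nodes _ _ _); rewrite /centerJ /centerI; field.
- apply: (euler_cell he hlq dx0 t0 _ _ opJ hs cfl) => //.
  + exact/(admissibleP _ he).
  + move=> x hx; apply/nI/right_half; move: hx.
    by congr (_ \in rule_nodes _ _ _); rewrite /centerJ /centerI; field.
  + move=> x hx; apply/nI/left_half; move: hx.
    by congr (_ \in rule_nodes _ _ _); rewrite /centerJ /centerI intrD; field.
Qed.

Lemma rk_pcpP (R : realType) (e : R -> R -> R) (K : nat)
    (x0 dx tau dt : R) (gq lq : quad_rule R) :
  eos_assumptions e -> 0 < dx -> 0 < tau ->
  is_gauss_lobatto lq -> (K + 3 < 2 * qsize lq)%N ->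
  tau <= qweight lq 1 * dx / 2 -> 0 < dt <= tau ->
  rk_pcp e K x0 dx tau gq lq dt.
Proof.
move=> he dx0 t0 hlq hL cfl hdt U Us Uss Ut Ust Usst LU LUs LUss
  [sp0 lim0 op0 st1 lim1 op1 st2 lim2 op2 next] a0.
have step A At LA : is_limited x0 dx gq lq A At ->
    is_dg_operator e K x0 dx tau gq At LA ->
    dg_space K A -> averages_admissible e x0 dx A ->
    [/\ dg_space K At, averages_admissible e x0 dx At,
        dg_space K (At + dt *: LA)
      & averages_admissible e x0 dx (At + dt *: LA)].
  move=> lim op sA aA; have sAt := is_limited_dg_space lim sA.
  have aAt := is_limited_averages dx0 lim aA.
  split => //; first by apply: dg_space_step => //; case: op.
  apply: (euler_step he dx0 t0 hlq hL cfl hdt sAt aAt _ op).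
  exact: is_limited_nodes he lim aA.
have q1 : 0 < 3 / 4 :> R by lra.
have q2 : 0 < 1 / 4 :> R by lra.
have q3 : 0 < 1 / 3 :> R by lra.
have q4 : 0 < 2 / 3 :> R by lra.
have all n : dg_space K (U n) -> averages_admissible e x0 dx (U n) ->
    [/\ averages_admissible e x0 dx (Us n), averages_admissible e x0 dx (Uss n),
        dg_space K (U n.+1) & averages_admissible e x0 dx (U n.+1)].
  move=> sU aU.
  have [sUt aUt ss as_] := step _ _ _ (lim0 n) (op0 n) sU aU.
  rewrite -st1 in ss as_.
  have [_ _ ss' as'] := step _ _ _ (lim1 n) (op1 n) ss as_.
  have sss : dg_space K (Uss n) by rewrite st2; exact: dg_space_comb.
  have ass : averages_admissible e x0 dx (Uss n).
    by rewrite st2; exact: averages_admissible_comb.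
  have [_ _ ss'' as''] := step _ _ _ (lim2 n) (op2 n) sss ass.
  split => //; rewrite next; first exact: dg_space_comb.
  exact: averages_admissible_comb.
have inv n : dg_space K (U n) /\ averages_admissible e x0 dx (U n).
  by elim: n => // n [sU aU]; have [] := all n sU aU.
move=> n; have [sU aU] := inv n; have [as_ ass _ _] := all n sU aU.
by split; split => //; apply: is_limited_nodes; eauto.
Qed.

Lemma ms_pcpP (R : realType) (e : R -> R -> R) (K : nat)
    (x0 dx tau dt : R) (gq lq : quad_rule R) :
  eos_assumptions e -> 0 < dx -> 0 < tau ->
  is_gauss_lobatto lq -> (K + 3 < 2 * qsize lq)%N ->
  tau <= qweight lq 1 * dx / 2 -> 0 < dt -> 3 * dt <= tau ->
  ms_pcp e K x0 dx tau gq lq dt.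
Proof.
move=> he dx0 t0 hlq hL cfl dt0 hdt U Ut LU [sp0 lim op next] a0.
have step s n : 0 < s <= tau ->
    dg_space K (U n) -> averages_admissible e x0 dx (U n) ->
    dg_space K (Ut n + s *: LU n) /\
    averages_admissible e x0 dx (Ut n + s *: LU n).
  move=> hs sU aU; have sUt := is_limited_dg_space (lim n) sU.
  have aUt := is_limited_averages dx0 (lim n) aU.
  split; first by apply: dg_space_step => //; case: (op n).
  apply: (euler_step he dx0 t0 hlq hL cfl hs sUt aUt _ (op n)).
  exact: is_limited_nodes he (lim n) aU.
have inv n : dg_space K (U n) /\ averages_admissible e x0 dx (U n).
  elim/ltn_ind: n => n IH; case: (leqP n 3) => [n3|].
    by split; [exact: sp0|exact: a0].
  case: n IH => // n IH n3; rewrite next //.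
  have [s1 a1] := IH n (leqnn _).
  have [s2 a2] : dg_space K (U (n - 3)%N) /\
      averages_admissible e x0 dx (U (n - 3)%N).
    by apply: IH; lia.
  have [|s1' a1'] := step (3 * dt) n _ s1 a1; first by apply/andP; split; lra.
  have [|s2' a2'] := step (12 / 11 * dt) (n - 3)%N _ s2 a2.
    by apply/andP; split; lra.
  split; first exact: (dg_space_comb _ _ s1' s2').
  by apply: (averages_admissible_comb he dx0 _ _ a1' a2'); lra.
move=> n; have [sU aU] := inv n; split => //.
exact: is_limited_nodes he (lim n) aU.
Qed.

Unset Implicit Arguments.

Theorem theorem4p3 (R : realType) (e : R -> R -> R) (K : nat)
    (x0 dx tau_max : R) (gq lq : quad_rule R)
    (he : eos_assumptions e) (hK : (1 <= K)%N)
    (hdx : 0 < dx) (htau : 0 < tau_max)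
    (hgq : is_gauss gq) (hQ : (K + 1 <= qsize gq)%N)
    (hlq : is_gauss_lobatto lq) (hL : (K + 3 < 2 * qsize lq)%N) :
  (forall dt : R,
     let theta := dt / tau_max in
     0 < dt <= qweight lq 1 * theta * dx / (2 * speed_of_light) ->
     0 < theta <= 1 ->
     rk_pcp e K x0 dx tau_max gq lq dt) /\
  (forall dt : R,
     let theta := dt / tau_max in
     0 < dt <= qweight lq 1 * theta * dx / (2 * speed_of_light) ->
     0 < theta <= 1 / 3 ->
     ms_pcp e K x0 dx tau_max gq lq dt).
Proof.
have cfl (dt : R) : 0 < dt ->
    dt <= qweight lq 1 * (dt / tau_max) * dx / (2 * speed_of_light) ->
    tau_max <= qweight lq 1 * dx / 2.
  move=> dt0; rewrite /speed_of_light mulr1.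
  have -> : qweight lq 1 * (dt / tau_max) * dx / 2 =
      dt * (qweight lq 1 * dx / 2 / tau_max) by field; rewrite gt_eqF.
  by rewrite -[leLHS]mulr1 ler_pM2l // ler_pdivlMr // mul1r.
split=> dt theta /andP[dt0 /(cfl dt dt0) htc] /andP[_].
- rewrite ler_pdivrMr // mul1r => hdt.
  by apply: rk_pcpP => //; rewrite dt0.
- rewrite ler_pdivrMr // => hdt.
  by apply: ms_pcpP => //; lra.
Qed.
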